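(* Let $\rho_b,\rho_h\ge0$ with $\rho_b+\rho_h\le1$. If $\rho_b\le\rho_h$, then for every $p\in[0,1]$ the golf process $(\eta^t)_{t\in[0,1]}$ on $\mathbb{Z}$ with parameters $\rho_b,\rho_h,p$ is valid.
   Context: Golf process on $\mathbb{Z}$ (edges $\{x,x+1\}$): the initial states $(\eta^0_x)_{x\in\mathbb{Z}}$ are i.i.d., each vertex containing a ball (state $1$) with probability $\rho_b$, a hole (state $-1$) with probability $\rho_h$, and being neutral (state $0$) otherwise. Clocks $C(v)$ are i.i.d. uniform on $[0,1]$, independent of the configuration. At time $C(v)$, if $v$ contains a ball, this ball performs a random walk (step $+1$ w.p. $p$, $-1$ w.p. $1-p$, independent of everything else) started at $v$, stopped at the first time it visits a currently free hole, which it fills; $v$ and that hole become neutral. If the walk never visits a free hole, the whole process becomes frozen (all states set to a cemetery state $\ast$ from then on). The process takes values in $\mathcal{S}=\{-1,0,1,\ast\}^{\mathbb{Z}}$ with the product topology. The process is called valid if it is almost surely well-defined and not frozen at time $1$, is measurable, and almost surely belongs to $D_{\mathcal{S}}[0,1]$, the space of càdlàg functions $[0,1]\to\mathcal{S}$ with the Skorokhod topology. *)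

(* Defs.v *)
From HB Require Import structures.
From mathcomp Require Import all_boot all_order all_algebra.
From mathcomp Require Import all_classical all_reals all_analysis.
Set Implicit Arguments. Unset Strict Implicit. Unset Printing Implicit Defensive.
Import Order.TTheory GRing.Theory Num.Theory.
Import numFieldNormedType.Exports.
Local Open Scope classical_set_scope.
Local Open Scope ring_scope.

(** * States of a vertex: hole (-1), neutral (0), ball (1), cemetery (star) *)
Inductive site := Hole | Neut | Ball | Star.

Section Dynamics.
Variable R : realType.

(** Deterministic data of one realization:
    e0 : initial configuration, C : clocks, xi v k : k-th step (+1/-1) of the
    random walk used by the ball initially at v. *)

Definition walk (xi : int -> nat -> int) (v : int) (n : nat) : int :=
  v + \sum_(k < n) xi v k.

(** A history h assigns to (some) balls v the hole h v = Some x they fill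
    (at time C v).  [free_before .. s x]: x is a hole not filled strictly
    before time s (i.e. free at time s-). *)
Definition free_before (e0 : int -> site) (C : int -> R)
    (h : int -> option int) (s : R) (x : int) : Prop :=
  e0 x = Hole /\ ~ (exists u, h u = Some x /\ C u < s).

Definition first_free_hole (e0 : int -> site) (C : int -> R)
    (xi : int -> nat -> int) (h : int -> option int) (v x : int) : Prop :=
  exists n, walk xi v n = x /\ free_before e0 C h (C v) x /\
    forall m, (m < n)%N -> ~ free_before e0 C h (C v) (walk xi v m).

Definition no_free_hole (e0 : int -> site) (C : int -> R)
    (xi : int -> nat -> int) (h : int -> option int) (v : int) : Prop :=
  forall n, ~ free_before e0 C h (C v) (walk xi v n).

Definition freezer (e0 : int -> site) (C : int -> R)
    (xi : int -> nat -> int) (h : int -> option int) (u : int) : Prop :=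
  e0 u = Ball /\ h u = None /\ no_free_hole e0 C xi h u.

Definition active (e0 : int -> site) (C : int -> R)
    (xi : int -> nat -> int) (h : int -> option int) (v : int) : Prop :=
  ~ (exists u, freezer e0 C xi h u /\ C u < C v).

Definition admissible (e0 : int -> site) (C : int -> R)
    (xi : int -> nat -> int) (h : int -> option int) : Prop :=
  forall v,
    (e0 v <> Ball -> h v = None) /\
    (e0 v = Ball -> active e0 C xi h v ->
       forall x, h v = Some x <-> first_free_hole e0 C xi h v x) /\
    (e0 v = Ball -> ~ active e0 C xi h v -> h v = None).

Definition frozen_by (e0 : int -> site) (C : int -> R)
    (xi : int -> nat -> int) (h : int -> option int) (t : R) : Prop :=
  exists u, freezer e0 C xi h u /\ C u <= t.

Definition traj (e0 : int -> site) (C : int -> R)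
    (xi : int -> nat -> int) (h : int -> option int) (t : R) : int -> site :=
  fun x =>
  if `[< frozen_by e0 C xi h t >] then Star else
  match e0 x with
  | Ball => if C x <= t then Neut else Ball
  | Hole => if `[< exists u, h u = Some x /\ C u <= t >] then Neut else Hole
  | s => s
  end.

Definition golf_path (e0 : int -> site) (C : int -> R)
    (xi : int -> nat -> int) : R -> int -> site :=
  match pselect (exists h, admissible e0 C xi h) with
  | left H => traj e0 C xi (projT1 (cid H))
  | right _ => fun _ _ => Star
  end.

Definition well_defined (e0 : int -> site) (C : int -> R)
    (xi : int -> nat -> int) : Prop :=
  exists! h, admissible e0 C xi h.

Definition not_frozen_at (e0 : int -> site) (C : int -> R)
    (xi : int -> nat -> int) (t : R) : Prop :=
  forall h, admissible e0 C xi h -> ~ frozen_by e0 C xi h t.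

(** * The space D_S[0,1], S = {-1,0,1,*}^Z with the product topology *)

(** s and s' agree on the window [-n, n] (basic product neighbourhoods) *)
Definition agree (n : nat) (s s' : int -> site) : Prop :=
  forall x : int, (absz x <= n)%N -> s x = s' x.

Definition cadlag (f : R -> int -> site) : Prop :=
  (forall t, 0 <= t -> t < 1 -> forall n : nat,
     exists2 d : R, 0 < d & forall s, t <= s -> s < t + d -> s <= 1 ->
       agree n (f s) (f t)) /\
  (forall t, 0 < t -> t <= 1 -> exists l : int -> site, forall n : nat,
     exists2 d : R, 0 < d & forall s, t - d < s -> s < t -> 0 <= s ->
       agree n (f s) l).

Definition time_change (lam : R -> R) : Prop :=
  (forall s t, 0 <= s -> s < t -> t <= 1 -> lam s < lam t) /\
  lam 0 = 0 /\ lam 1 = 1 /\ {within `[0, 1]%classic, continuous lam}.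

(** Skorokhod (J1) neighbourhoods *)
Definition sk_nbhd (f : R -> int -> site) (n : nat) (e : R) :
    set (R -> int -> site) :=
  [set g | exists lam, time_change lam /\
     (forall t, 0 <= t -> t <= 1 -> `|lam t - t| < e) /\
     (forall t, 0 <= t -> t <= 1 -> agree n (g (lam t)) (f t))].

Definition sk_open (U : set (R -> int -> site)) : Prop :=
  U `<=` cadlag /\
  forall f, U f -> exists n : nat, exists2 e : R, 0 < e &
     (sk_nbhd f n e `&` cadlag) `<=` U.

Definition sk_borel : set (set (R -> int -> site)) := <<s sk_open >>.

End Dynamics.

Definition mutually_independent d (T : measurableType d) (R : realType)
    (P : probability T R) (I : eqType) (X : I -> T -> R) : Prop :=
  forall (J : seq I) (B : I -> set R), uniq J ->
    (forall i, measurable (B i)) ->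
    fine (P (\bigcap_(i in [set i | i \in J]) (X i @^-1` B i))) =
    \prod_(i <- J) fine (P (X i @^-1` B i)).

Definition golf_family (T : Type) (R : Type) (eta0 clk : int -> T -> R)
    (step : int -> nat -> T -> R) : (int + int + (int * nat))%type -> T -> R :=
  fun i => match i with
  | inl (inl x) => eta0 x
  | inl (inr v) => clk v
  | inr (v, k) => step v k
  end.

(** eta0 x : initial state of x (values -1, 0, 1); clk v : clock of v;
    step v k : k-th step (+1 / -1) of the walk of the ball started at v. *)
Definition golf_inputs d (T : measurableType d) (R : realType)
    (P : probability T R) (rb rh p : R) (eta0 clk : int -> T -> R)
    (step : int -> nat -> T -> R) : Prop :=
  (forall x, measurable_fun setT (eta0 x)) /\
  (forall v, measurable_fun setT (clk v)) /\
  (forall v k, measurable_fun setT (step v k)) /\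
  (forall x, [/\ P (eta0 x @^-1` [set 1]) = rb%:E,
                 P (eta0 x @^-1` [set -1]) = rh%:E &
                 P (eta0 x @^-1` [set 0]) = (1 - rb - rh)%:E]) /\
  (forall v s, 0 <= s -> s <= 1 ->
      P (clk v @^-1` `]-oo, s]%classic) = s%:E) /\
  (forall v k, P (step v k @^-1` [set 1]) = p%:E /\
               P (step v k @^-1` [set -1]) = (1 - p)%:E) /\
  mutually_independent P (golf_family eta0 clk step).

Definition site_of (R : realType) (r : R) : site :=
  if r == 1 then Ball else if r == -1 then Hole else Neut.

Definition stepZ (R : realType) (r : R) : int := if r == 1 then 1 else -1.

Definition init_of d (T : measurableType d) (R : realType)
    (eta0 : int -> T -> R) (w : T) : int -> site := fun x => site_of (eta0 x w).
Definition clocks_of d (T : measurableType d) (R : realType)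
    (clk : int -> T -> R) (w : T) : int -> R := fun v => clk v w.
Definition steps_of d (T : measurableType d) (R : realType)
    (step : int -> nat -> T -> R) (w : T) : int -> nat -> int :=
  fun v k => stepZ (step v k w).

Definition golf_process d (T : measurableType d) (R : realType)
    (eta0 clk : int -> T -> R) (step : int -> nat -> T -> R) (w : T) :
    R -> int -> site :=
  golf_path (init_of eta0 w) (clocks_of clk w) (steps_of step w).

Definition golf_valid d (T : measurableType d) (R : realType)
    (P : probability T R) (eta0 clk : int -> T -> R)
    (step : int -> nat -> T -> R) : Prop :=
  exists A : set T, [/\ measurable A, P A = 1%E,
    (forall w, A w ->
       [/\ well_defined (init_of eta0 w) (clocks_of clk w) (steps_of step w),
           not_frozen_at (init_of eta0 w) (clocks_of clk w) (steps_of step w) 1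
         & cadlag (golf_process eta0 clk step w)]) &
    (forall B, sk_borel B ->
       measurable (A `&` (golf_process eta0 clk step) @^-1` B))].

(* Main.v *)
(** A ball cannot pass a free hole. If a ball-hole potential drifts to infinity in both
    directions, as it does almost surely at every time [t < 1] because the balls released
    by then have density [t * rb < rh], then every sufficiently long block keeps a free
    hole up to time [t], since the balls available to it are fewer than its holes.
    Such holes cut the line into finite pieces, on which the history is determined by
    induction on the clocks. As no clock equals [1], this covers all of [[0, 1]].

    The delicate point is uniqueness: a history could be fed "from infinity", all holes of
    a half-line being filled before some time [s]. Such a tail forces another one at an
    earlier time [s' < s], and in between infinitely many balls of the half-line are
    released; they are not allowed to freeze the process, yet only finitely many holes
    are within their reach.

    The reachability relation that defines the history is a countable union of events
    of the inputs, and a Skorokhod open set is a union of countably many events that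
    prescribe, on a finite window, the states and the balls causing the jumps, with
    rational bounds on the jump times. *)

Require Import Defs.
From HB Require Import structures.
From mathcomp Require Import all_boot all_order all_algebra.
From mathcomp Require Import all_classical all_reals all_analysis.
From mathcomp Require Import measurable_realfun.
From mathcomp Require Import zify ring lra.
Set Implicit Arguments. Unset Strict Implicit. Unset Printing Implicit Defensive.
Import Order.TTheory GRing.Theory Num.Theory.
Import numFieldNormedType.Exports.
Local Open Scope classical_set_scope.
Local Open Scope ring_scope.

(** * Finite searches, counting, and integer intervals *)

Section FiniteSearch.
Variables (R : realType) (I : eqType) (C : I -> R).

Lemma seq_argmin (s : seq I) (Q : I -> Prop) :
  (exists2 u, u \in s & Q u) ->
  exists u, [/\ u \in s, Q u & forall v, v \in s -> Q v -> C u <= C v].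
Proof.
elim: s => [|a s IH]; first by case.
move=> [u us Qu].
have [[w [ws Qw wmin]]|no] := pselect (exists u, [/\ u \in s, Q u &
    forall v, v \in s -> Q v -> C u <= C v]); last first.
  have nos v : v \in s -> Q v -> False by move=> vs Qv; apply/no/IH; exists v.
  have ua : u = a.
    by move: us; rewrite inE => /orP[/eqP//|/nos]; move/(_ Qu).
  exists a; split; [exact: mem_head|by rewrite -ua|].
  move=> v; rewrite inE => /orP[/eqP ->//|vs Qv].
  by case: (nos v).
have [Qa|nQa] := pselect (Q a); last first.
  exists w; split=> //; first by rewrite inE ws orbT.
  move=> v; rewrite inE => /orP[/eqP ->//|]; exact: wmin.
have [le|lt] := leP (C w) (C a).
  exists w; split=> //; first by rewrite inE ws orbT.
  by move=> v; rewrite inE => /orP[/eqP ->//|]; exact: wmin.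
exists a; split=> //; first exact: mem_head.
move=> v; rewrite inE => /orP[/eqP ->//|vs Qv].
exact: le_trans (ltW lt) (wmin _ vs Qv).
Qed.

(** Infinitely many clocks need not be well-ordered, so induction on time is available only inside a
    finite list, where a counterexample of least clock exists. *)
Lemma seq_clock_ind (s : seq I) (Q : I -> Prop) :
  (forall v, v \in s -> (forall u, u \in s -> C u < C v -> Q u) -> Q v) ->
  forall v, v \in s -> Q v.
Proof.
move=> H v vs; apply: contrapT => nQv.
have [|u [us nQu umin]] := @seq_argmin s (fun u => ~ Q u); first by exists v.
apply: nQu; apply: H => // w ws lt; apply: contrapT => nQw.
by have := umin _ ws nQw; rewrite leNgt lt.
Qed.

Lemma seq_max_nat (s : seq I) (P : I -> nat -> Prop) :
  (forall x n m, (n <= m)%N -> P x n -> P x m) ->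
  (forall x, x \in s -> exists n, P x n) ->
  exists n, forall x, x \in s -> P x n.
Proof.
move=> mono; elim: s => [|a s IH] H; first by exists 0%N.
have [|n Hn] := IH; first by move=> x xs; apply: H; rewrite inE xs orbT.
have [m Hm] := H a (mem_head _ _).
exists (maxn n m) => x; rewrite inE => /orP[/eqP ->|xs].
  exact: mono (leq_maxr _ _) Hm.
exact: mono (leq_maxl _ _) (Hn _ xs).
Qed.

(** A pigeonhole principle for a relation: each element of [A] uses up its own partner in [B], which
    is removed before the induction goes on. *)
Lemma inj_size_le (A B : seq I) (F : I -> I -> Prop) :
  uniq A ->
  (forall x, x \in A -> exists2 u, u \in B & F u x) ->
  (forall u x y, F u x -> F u y -> x = y) ->
  (size A <= size B)%N.
Proof.
elim: A B => [|a A IH] B //= /andP[aA uA] H inj.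
have [u uB Fu] := H a (mem_head _ _).
suff : (size A <= size (rem u B))%N.
  rewrite size_rem //; have : (0 < size B)%N by case: B uB {H IH}.
  by case: (size B).
apply: IH => // x xA.
have [v vB Fv] := H x (mem_behead (s := a :: A) xA).
exists v => //; have /perm_mem/(_ v) := perm_to_rem uB.
rewrite vB inE; case: eqP => [vu|_] /esym // _.
have ax : a = x by apply: inj Fu _; rewrite -vu.
by rewrite ax xA in aA.
Qed.

End FiniteSearch.

Lemma nat_argmin (Q : nat -> Prop) :
  (exists n, Q n) -> exists n, Q n /\ forall m, (m < n)%N -> ~ Q m.
Proof.
move=> [n Qn].
have ex : exists n, `[< Q n >] by exists n; apply/asboolP.
exists (ex_minn ex); case: ex_minnP => m /asboolP Qm mmin; split=> // k km.
by move/asboolP/mmin; rewrite leqNgt km.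
Qed.

Lemma int_max_below (Q : int -> Prop) (a : int) :
  (exists2 y, y < a & Q y) ->
  exists y, [/\ y < a, Q y & forall x, y < x -> x < a -> ~ Q x].
Proof.
move=> [y ya Qy].
have [|n [Qn nmin]] := @nat_argmin (fun n => Q (a - 1 - n%:Z)).
  exists (absz (a - 1 - y)%R).
  by have -> : a - 1 - (absz (a - 1 - y)%R)%:Z = y by lia.
exists (a - 1 - n%:Z); split=> //; first by lia.
move=> x x1 x2 Qx; apply: (nmin (absz (a - 1 - x)%R)); first by lia.
by have -> : a - 1 - (absz (a - 1 - x)%R)%:Z = x by lia.
Qed.

Lemma int_min_above (Q : int -> Prop) (b : int) :
  (exists2 y, b < y & Q y) ->
  exists y, [/\ b < y, Q y & forall x, b < x -> x < y -> ~ Q x].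
Proof.
move=> [y yb Qy].
have [|z [zb Qz zmax]] := @int_max_below (fun y => Q (- y)) (- b).
  by exists (- y); [lia | rewrite opprK].
exists (- z); split=> //; first by lia.
move=> x x1 x2 Qx; apply: (zmax (- x)); [lia|lia|by rewrite opprK].
Qed.

Definition irange (a : int) (n : nat) : seq int := [seq a + i%:Z | i <- iota 0 n].

Lemma mem_irange a n x : (x \in irange a n) = (a <= x < a + n%:Z).
Proof.
apply/mapP/idP => [[i]|/andP[h1 h2]].
  by rewrite mem_iota => /andP[_ h] ->; apply/andP; split; lia.
exists (absz (x - a)%R); last by lia.
by rewrite mem_iota; lia.
Qed.

Lemma irange_uniq a n : uniq (irange a n).
Proof. by rewrite map_inj_uniq ?iota_uniq // => i j; lia. Qed.

Definition between (y z : int) : seq int := irange (y + 1) (absz (z - y - 1)%R).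

Lemma mem_between y z x : y < z -> (x \in between y z) = (y < x < z).
Proof. by move=> yz; rewrite mem_irange; apply/idP/idP; lia. Qed.

(** The flag lets both half-lines share one proof: [true] stands for the left one, [false] for the
    right one. *)
Definition beyond (b : bool) (M x : int) : Prop := if b then x < M else M < x.

(** * Reachable holes and existence of a history *)

Section Dynamics.
Variables (R : realType) (e0 : int -> site) (C : int -> R).
Variable (xi : int -> nat -> int).
Hypothesis xi_unit : forall v k, xi v k = 1 \/ xi v k = -1.

Local Notation w := (walk xi).

Lemma walk0 v : w v 0 = v.
Proof. by rewrite /walk big_ord0 addr0. Qed.

Lemma walkS v n : w v n.+1 = w v n + xi v n.
Proof. by rewrite /walk big_ord_recr /= addrA. Qed.

(** Discrete intermediate values: a unit step that does not end at [y] cannot have jumped over it,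
    so the situation is the same one step earlier. *)
Lemma walk_cross v n y :
  (v <= y /\ y <= w v n) \/ (w v n <= y /\ y <= v) ->
  exists2 m, (m <= n)%N & w v m = y.
Proof.
elim: n => [|n IH] H.
  by exists 0%N => //; move: H; rewrite walk0; lia.
have [e|ne] := eqVneq (w v n.+1) y; first by exists n.+1.
have [|m mn e] := IH; last by exists m => //; exact: leqW.
move/eqP: ne; move: H; rewrite walkS.
by case: (xi_unit v n) => ->; lia.
Qed.

(** The walk of [v] arrives at [x] after passing only holes reached by earlier balls;
    [x] itself may have been filled before. Being positive in the earlier claims, this
    is monotone in [k], unlike the filling relation. Restricting to the balls of
    [-k, k] makes the counting argument of [block_reach] finite. *)
Fixpoint reach (k : nat) (v x : int) : Prop :=
  match k with
  | 0%N => False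
  | k'.+1 => (absz v <= k)%N /\ e0 v = Ball /\ e0 x = Hole /\
     exists n, w v n = x /\ forall m, (m < n)%N -> e0 (w v m) = Hole ->
       exists u, C u < C v /\ reach k' u (w v m)
  end.

Definition reachable (v x : int) : Prop := exists k, reach k v x.

Definition reached_before (s : R) (x : int) : Prop :=
  exists u, reachable u x /\ C u < s.

Lemma reach_mono k l v x : (k <= l)%N -> reach k v x -> reach l v x.
Proof.
elim: k l v x => [|k IH] [|l] v x //= kl [vk [bv [hx [n [e H]]]]].
split; first exact: leq_trans vk kl.
do 2![split=> //]; exists n; split=> // m mn hm; have [u [lt r]] := H m mn hm.
by exists u; split=> //; apply: IH r.
Qed.

Lemma reach_inv k v x : reach k v x -> [/\ (absz v <= k)%N, e0 v = Ball, e0 x = Hole &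
  exists n, w v n = x /\ forall m, (m < n)%N -> e0 (w v m) = Hole ->
    exists u, C u < C v /\ reach k u (w v m)].
Proof.
case: k => // k [vk [bv [hx [n [e H]]]]]; split=> //.
exists n; split=> // m mn hm; have [u [lt r]] := H m mn hm.
by exists u; split=> //; apply: reach_mono r.
Qed.

Lemma reachable_inv v x : reachable v x -> [/\ e0 v = Ball, e0 x = Hole &
  exists n, w v n = x /\ forall m, (m < n)%N -> e0 (w v m) = Hole ->
    exists u, C u < C v /\ reachable u (w v m)].
Proof.
move=> [k /reach_inv[_ bv hx [n [e H]]]]; split=> //.
exists n; split=> // m mn hm; have [u [lt r]] := H m mn hm.
by exists u; split=> //; exists k.
Qed.

(** The walk visits finitely many sites before its arrival, so one level serves all the earlier
    claims; the new level must also bound [absz v]. *)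
Lemma reachable_intro v x n : e0 v = Ball -> e0 x = Hole -> w v n = x ->
  (forall m, (m < n)%N -> e0 (w v m) = Hole ->
    exists u, C u < C v /\ reachable u (w v m)) -> reachable v x.
Proof.
move=> bv hx e H.
have [||k Hk] := @seq_max_nat _ (iota 0 n) (fun m k => e0 (w v m) = Hole ->
    exists u, C u < C v /\ reach k u (w v m)).
- move=> m i j ij Hi /Hi[u [lt r]]; exists u; split=> //.
  exact: reach_mono r.
- move=> m; rewrite mem_iota add0n => /andP[_ mn].
  have [hm|nh] := pselect (e0 (w v m) = Hole); last by exists 0%N.
  by have [u [lt [k r]]] := H m mn hm; exists k; exists u.
exists (maxn k (absz v)).+1 => /=; split; first by rewrite leqW // leq_maxr.
do 2![split=> //]; exists n; split=> // m mn hm.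
have [|u [lt r]] := Hk m _ hm; first by rewrite mem_iota add0n mn.
exists u; split=> //; apply: reach_mono r; exact: leq_maxl.
Qed.

(** This is how a ball cannot pass a free hole: the walk visits [y] before its arrival at [x], so an
    earlier ball has reached [y]. *)
Lemma reach_cross k v x y : reach k v x -> e0 y = Hole ->
  (v < y /\ y < x) \/ (x < y /\ y < v) ->
  exists u, C u < C v /\ reach k u y.
Proof.
move=> /reach_inv[_ _ _ [n [e H]]] hy side.
have [|m mn em] := @walk_cross v n y; first by rewrite e; lia.
have mn' : (m < n)%N.
  rewrite ltn_neqAle mn andbT; apply/eqP => mne; rewrite mne in em; lia.
by have := H m mn'; rewrite em; apply.
Qed.

Lemma reachable_cross v x y : reachable v x -> e0 y = Hole ->
  (v < y /\ y < x) \/ (x < y /\ y < v) ->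
  exists u, C u < C v /\ reachable u y.
Proof.
move=> [k r] hy side; have [u [lt ru]] := reach_cross r hy side.
by exists u; split=> //; exists k.
Qed.

(** Of two distinct holes the walk of [u] meets one first, and passing it requires an earlier ball
    that reaches it, against the minimality of [C u]. *)
Lemma reach_first_inj k u x y : reach k u x -> reach k u y ->
  (forall v, reach k v x -> C u <= C v) ->
  (forall v, reach k v y -> C u <= C v) -> x = y.
Proof.
move=> /reach_inv[_ _ hx [n [ex Hx]]] /reach_inv[_ _ hy [n' [ey Hy]]] mx my.
have [lt|lt|nn] := ltngtP n n'; last by rewrite -ex -ey nn.
- have := Hy n lt; rewrite ex => /(_ hx)[v [cv rv]].
  by have := mx v rv; rewrite leNgt cv.
- have := Hx n' lt; rewrite ey => /(_ hy)[v [cv rv]].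
  by have := my v rv; rewrite leNgt cv.
Qed.

(** * The ball-hole potential and its blocks *)

Definition drift (t : R) (x : int) : int :=
  match e0 x with
  | Hole => 1
  | Ball => if C x <= t then -1 else 0
  | _ => 0
  end.

(** A discrete antiderivative of [drift] that vanishes at [0]; the minus sign on the negative side
    makes the increments telescope over the whole line. *)
Definition pot (t : R) (z : int) : int :=
  match z with
  | Posz n => \sum_(i < n) drift t (Posz i)
  | Negz n => - \sum_(i < n.+1) drift t (Negz i)
  end.

Lemma pot_succ t x : pot t (x + 1) = pot t x + drift t x.
Proof.
case: x => n.
  by rewrite (_ : Posz n + 1 = Posz n.+1) /= ?big_ord_recr //; lia.
case: n => [|n].
  have -> : Negz 0 + 1 = 0 by lia.
  rewrite /= big_ord0 big_ord_recr big_ord0 /= add0r addNr //.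
have -> : Negz n.+1 + 1 = Negz n by lia.
by rewrite /= [in RHS]big_ord_recr /= opprD addrNK.
Qed.

Definition holeb x := if e0 x is Hole then true else false.
Definition ballb t x := if e0 x is Ball then C x <= t else false.

Lemma pot_count t y n : pot t (y + n%:Z) + (size (seq.filter (ballb t) (irange y n)))%:Z =
  pot t y + (size (seq.filter holeb (irange y n)))%:Z.
Proof.
elim: n => [|n IH]; first by rewrite /irange /= !addr0.
have iS : irange y n.+1 = rcons (irange y n) (y + n%:Z).
  by rewrite /irange -[n.+1]addn1 iotaD map_cat /= add0n cats1.
rewrite iS !filter_rcons.
have -> : y + n.+1%:Z = y + n%:Z + 1 by lia.
rewrite pot_succ.
move: IH; rewrite /drift /ballb /holeb; case: (e0 _) => //=; rewrite ?size_rcons;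
  try by move=> IH; lia.
by case: ifP => _ IH; rewrite ?size_rcons; lia.
Qed.

Lemma pot_step t x n : `|pot t (x + n%:Z) - pot t x| <= n%:Z.
Proof.
elim: n => [|n IH]; first by rewrite addr0 subrr normr0.
have -> : x + n.+1%:Z = x + n%:Z + 1 by lia.
rewrite pot_succ; move: IH; rewrite /drift.
by case: (e0 _) => //; try case: ifP => _; lia.
Qed.

(** Holes matched injectively with released balls are at most as many as these balls. Every counting
    argument ends by setting this against [block]. The increment starts at [y + 1] because both end
    points are left out. *)
Lemma pot_le_of_matching t y z (F : int -> int -> Prop) : y < z ->
  (forall x, y < x -> x < z -> e0 x = Hole ->
    exists u, [/\ y < u, u < z, e0 u = Ball, C u <= t & F u x]) ->
  (forall u x x', F u x -> F u x' -> x = x') ->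
  pot t z - pot t (y + 1) <= 0.
Proof.
move=> yz H inj.
have := pot_count t (y + 1) (absz (z - y - 1)%R).
have -> : y + 1 + (absz (z - y - 1)%R)%:Z = z by lia.
suff : (size (seq.filter holeb (between y z)) <= size (seq.filter (ballb t) (between y z)))%N.
  by rewrite /between; lia.
apply: (@inj_size_le _ _ _ F) => //; first by rewrite filter_uniq // irange_uniq.
move=> x; rewrite mem_filter mem_between // /holeb => /andP[hx /andP[yx xz]].
have hx' : e0 x = Hole by move: hx; case: (e0 x).
have [u [yu uz bu cu Fu]] := H x yx xz hx'.
by exists u => //; rewrite mem_filter /ballb bu cu mem_between // yu.
Qed.

(** Such a block keeps a free hole up to time [t]. *)
Definition block (t : R) (p q : int) : Prop :=
  p <= q /\ forall y z, y < p -> q < z -> 0 < pot t z - pot t (y + 1).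

Hypothesis pot_pinfty : forall t, t < 1 -> forall K, exists N, forall z, N <= z -> K < pot t z.
Hypothesis pot_ninfty : forall t, t < 1 -> forall K, exists N, forall z, z <= N -> pot t z < K.

(** The end of the block next to [M] is fixed. Past that end the potential is bounded on one side by
    a constant: [pot_step] controls it on a finite stretch and the limit hypothesis afterwards. The
    far end is put where the potential has crossed this constant for good. *)
Lemma block_exists t b M : t < 1 ->
  exists p q, block t p q /\ forall x, p <= x -> x <= q -> beyond b M x.
Proof.
move=> t1; case: b; rewrite /beyond.
  have [N HN] := pot_pinfty t1 0.
  pose D := pot t M - `|N - M|.
  have HD z : M <= z -> Num.min D 0 <= pot t z.
    move=> Mz; have [/HN|zN] := leP N z; first by lia.
    have := pot_step t M (absz (z - M)%R).
    have -> : M + (absz (z - M)%R)%:Z = z by lia.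
    by rewrite /D; lia.
  have [N' HN'] := pot_ninfty t1 (Num.min D 0).
  exists (Num.min N' (M - 1)), (M - 1); split; last by move=> x; lia.
  split; first by lia.
  move=> y z y1 z1; have := HN' (y + 1); have := HD z; lia.
have [N HN] := pot_ninfty t1 0.
pose D := pot t N + `|M + 1 - N|.
have HD z : z <= M + 1 -> pot t z <= Num.max D 0.
  move=> Mz; have [/HN|zN] := leP z N; first by lia.
  have := pot_step t N (absz (z - N)%R).
  have -> : N + (absz (z - N)%R)%:Z = z by lia.
  by rewrite /D; lia.
have [N' HN'] := pot_pinfty t1 (Num.max D 0).
exists (M + 1), (Num.max N' (M + 1)); split; last by move=> x; lia.
split; first by lia.
move=> y z y1 z1; have := HN' z; have := HD (y + 1); lia.
Qed.

(** If all holes of the block were reached before [t], the block could be enlarged to the nearest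
    unreached holes on both sides. No ball counted so far crosses these, so the first reachers of
    the holes in between form a matching, which contradicts the growth of the potential. *)
Lemma block_reach t p q k : block t p q ->
  exists x, [/\ p <= x, x <= q, e0 x = Hole & forall u, reach k u x -> t <= C u].
Proof.
move=> [pq Hpq]; apply: contrapT => no.
have allr x : p <= x -> x <= q -> e0 x = Hole -> exists2 u, reach k u x & C u < t.
  move=> px xq hx; apply: contrapT => no2; apply: no; exists x; split=> // u r.
  by rewrite leNgt; apply/negP => lt; apply: no2; exists u.
pose free x := e0 x = Hole /\ forall u, reach k u x -> t <= C u.
have notfree x : ~ free x -> e0 x = Hole -> exists2 u, reach k u x & C u < t.
  move=> nf hx; apply: contrapT => no2; apply: nf; split=> // u r.
  by rewrite leNgt; apply/negP => lt; apply: no2; exists u.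
(* The alternative [x < - k] guarantees that the search succeeds; it is a barrier too, since balls
   of level [k] start in [[-k, k]]. *)
have [|y [yp wy ymax]] := @int_max_below (fun x => free x \/ x < - k%:Z) p.
  by exists (Num.min (p - 1) (- k%:Z - 1)); [lia|right; lia].
have [|z [zq wz zmin]] := @int_min_above (fun x => free x \/ k%:Z < x) q.
  by exists (Num.max (q + 1) (k%:Z + 1)); [lia|right; lia].
have := Hpq y z yp zq; suff : pot t z - pot t (y + 1) <= 0 by lia.
apply: (@pot_le_of_matching t y z (fun u x => reach k u x /\
   forall v, reach k v x -> C u <= C v)); first by lia.
- move=> x yx xz hx.
  have [u0 r0 c0] : exists2 u, reach k u x & C u < t.
    have [px|xp] := leP p x; last first.
      by apply: notfree => // f; apply: (ymax x) => //; left.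
    have [xq|qx] := leP x q; first exact: allr.
    by apply: notfree => // f; apply: (zmin x) => //; left.
  have [|u [_ ru umin]] := @seq_argmin _ _ C (irange (- k%:Z) (k + k).+1)
      (fun u => reach k u x).
    by exists u0 => //; have [] := reach_inv r0; rewrite mem_irange; lia.
  have umin' v : reach k v x -> C u <= C v.
    by move=> rv; apply: umin (rv); have [] := reach_inv rv; rewrite mem_irange; lia.
  have cu : C u < t by apply: le_lt_trans c0; exact: umin'.
  have [uk bu _ _] := reach_inv ru.
  have nfree s : free s -> ~ ((u < s /\ s < x) \/ (x < s /\ s < u)).
    move=> [hs fs] side; have [v [cv rv]] := reach_cross ru hs side.
    by have := fs v rv; rewrite leNgt (lt_trans cv cu).
  have nfree' s : free s -> u <> s by move=> [hs _] us; rewrite -us bu in hs.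
  exists u; split=> //; last exact: ltW.
    case: wy => [f|]; last by lia.
    by have := nfree _ f; have := nfree' _ f; lia.
  case: wz => [f|]; last by lia.
  by have := nfree _ f; have := nfree' _ f; lia.
- by move=> u x x' [r1 m1] [r2 m2]; apply: reach_first_inj r1 r2 m1 m2.
Qed.

(** A block is finite, so if all its holes were reached before [t], a single level [k] would witness
    this, against [block_reach]. *)
Lemma reach_sep t b M : t < 1 ->
  exists x, [/\ beyond b M x, e0 x = Hole & ~ reached_before t x].
Proof.
move=> t1; have [p [q [blk bey]]] := block_exists b M t1.
apply: contrapT => no.
have [||k Hk] := @seq_max_nat _ (irange p (absz (q - p + 1)%R))
   (fun x k => e0 x = Hole -> exists2 u, reach k u x & C u < t).
- move=> x n m nm H /H[u r c]; exists u => //; exact: reach_mono r.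
- move=> x; rewrite mem_irange => xr.
  have [hx|nh] := pselect (e0 x = Hole); last by exists 0%N.
  have [[u [[k r] c]]|nr] := pselect (reached_before t x).
    by exists k => _; exists u.
  by case: no; exists x; split=> //; apply: bey; case: blk => pq _; lia.
have [x [px xq hx H]] := block_reach k blk.
have xr : x \in irange p (absz (q - p + 1)%R) by rewrite mem_irange; lia.
have [u r c] := Hk x xr hx.
by have := H u r; rewrite leNgt c.
Qed.

(** * Construction of an admissible history *)

Definition fills (v x : int) : Prop := reachable v x /\ ~ reached_before (C v) x.

Lemma fills_inj v x y : fills v x -> fills v y -> x = y.
Proof.
move=> [/reachable_inv[_ hx [n [ex Hx]]] nx] [/reachable_inv[_ hy [n' [ey Hy]]] ny].
have [lt|lt|nn] := ltngtP n n'; last by rewrite -ex -ey nn.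
- by have := Hy n lt; rewrite ex => /(_ hx)[v' [cv rv]]; case: nx; exists v'.
- by have := Hx n' lt; rewrite ey => /(_ hy)[v' [cv rv]]; case: ny; exists v'.
Qed.

Definition history (v : int) : option int :=
  match pselect (exists x, fills v x) with
  | left H => Some (projT1 (cid H))
  | right _ => None
  end.

Lemma historyP v x : history v = Some x <-> fills v x.
Proof.
rewrite /history; case: pselect => [H|nH]; last first.
  by split=> // f; case: nH; exists x.
case: (cid H) => y fy /=; split=> [[<-]//|fx].
by congr Some; apply: fills_inj fy fx.
Qed.

Hypothesis clock_lt1 : forall v, C v < 1.

Lemma clock_gap v : exists2 t, C v < t & t < 1.
Proof. by exists ((C v + 1) / 2); have := clock_lt1 v; lra. Qed.

(** A least clock among infinitely many balls need not exist. Here holes that stay unreached until a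
    time [t] just after [C u] confine all competitors to a finite interval. *)
Lemma first_reacher u x : reachable u x ->
  exists u', history u' = Some x /\ C u' <= C u.
Proof.
move=> r; have [t ut t1] := clock_gap u.
have [y [yx hy ny]] := reach_sep true x t1.
have [z [xz hz nz]] := reach_sep false x t1.
rewrite /beyond in yx xz; have yz : y < z by lia.
have loc v : reachable v x -> C v <= C u -> v \in between y z.
  move=> rv cv; rewrite mem_between //.
  have cvt : C v < t by exact: le_lt_trans ut.
  have aux s : e0 s = Hole -> ~ reached_before t s ->
      v <> s /\ ~ ((v < s /\ s < x) \/ (x < s /\ s < v)).
    move=> hs ns; split; first by move=> vs; have [bv _ _] := reachable_inv rv;
      rewrite vs hs in bv.
    move=> side; have [u' [cu' ru']] := reachable_cross rv hs side.
    by apply: ns; exists u'; split=> //; apply: lt_trans cvt.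
  by have := aux y hy ny; have := aux z hz nz; lia.
have [|u' [_ [ru' cu'] umin]] := @seq_argmin _ _ C (between y z)
    (fun v => reachable v x /\ C v <= C u).
  by exists u; [exact: loc|].
exists u'; split=> //; apply/historyP; split=> // -[v [rv cv]].
have cvu : C v <= C u by apply: le_trans cu'; exact: ltW.
by have := umin v (loc v rv cvu) (conj rv cvu); rewrite leNgt cv.
Qed.

(** This translates between filling and the positive notion of reaching: a reached hole has been
    filled by its first reacher, no later. *)
Lemma free_history s x : free_before e0 C history s x <->
  e0 x = Hole /\ ~ reached_before s x.
Proof.
split=> -[hx H]; split=> //.
  move=> [u [ru cu]]; have [u' [hu' cu']] := first_reacher ru.
  by apply: H; exists u'; split=> //; apply: le_lt_trans cu.
by move=> [u [/historyP[ru _] cu]]; apply: H; exists u.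
Qed.

Hypothesis walk_unbounded : forall v (M : nat), exists n, (M <= absz (w v n))%N.

(** An unbounded walk with unit steps must visit one of two free holes that enclose its start. *)
Lemma no_freezer_of_free (h : int -> option int) u :
  (forall b M, exists x, beyond b M x /\ free_before e0 C h (C u) x) ->
  ~ freezer e0 C xi h u.
Proof.
move=> sep [_ [_ nf]].
have [x [ux fx]] := sep true u; have [y [uy fy]] := sep false u.
rewrite /beyond in ux uy.
have [n Hn] := walk_unbounded u (maxn (absz x) (absz y)).
have [un|nu] := leP u (w u n).
  have [|m _ em] := @walk_cross u n y; first by lia.
  by apply: (nf m); rewrite em.
have [|m _ em] := @walk_cross u n x; first by lia.
by apply: (nf m); rewrite em.
Qed.

Lemma history_no_freezer u : ~ freezer e0 C xi history u.
Proof.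
apply: no_freezer_of_free => b M.
have [x [bx hx nx]] := reach_sep b M (clock_lt1 u).
by exists x; split=> //; apply/free_history.
Qed.

(** By [free_history], passing only holes reached earlier is the same as meeting no free hole, so
    [fills] is the rule of the first free hole; inactive balls do not occur. *)
Lemma history_admissible : admissible e0 C xi history.
Proof.
move=> v; split; last split.
- move=> nb; case e: (history v) => [x|] //.
  by move/historyP: e => -[/reachable_inv[bv]].
- move=> bv _ x; split.
    move/historyP=> [rv nr]; have [_ hx [n [e H]]] := reachable_inv rv.
    exists n; split=> //; split; first by apply/free_history.
    move=> m mn /free_history[hm nm]; apply: nm.
    by have [u [cu ru]] := H m mn hm; exists u.
  move=> [n [e [/free_history[hx nx] H]]]; apply/historyP; split=> //.
  apply: (@reachable_intro _ _ n) => // m mn hm; apply: contrapT => no.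
  apply: (H m mn); apply/free_history; split=> // -[u [ru cu]].
  by apply: no; exists u.
- by move=> _ /contrapT [u [/history_no_freezer]].
Qed.

(** * Uniqueness of the admissible history *)

Section Uniqueness.
Hypothesis clock_inj : forall u v, C u = C v -> u = v.
Hypothesis clock_gt0 : forall v, 0 < C v.
Hypothesis many_balls : forall s s', 0 < s -> s < s' -> s' < 1 -> forall b M,
  exists v, [/\ beyond b M v, e0 v = Ball, s < C v & C v < s'].

Definition filled_before (h : int -> option int) (s : R) (x : int) : Prop :=
  exists u, h u = Some x /\ C u < s.

Lemma admissible_some h v x : admissible e0 C xi h -> h v = Some x ->
  [/\ e0 v = Ball, active e0 C xi h v & first_free_hole e0 C xi h v x].
Proof.
move=> ad hv; have [nb [act inact]] := ad v.
have bv : e0 v = Ball by apply: contrapT => /nb; rewrite hv.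
have av : active e0 C xi h v by apply: contrapT => /(inact bv); rewrite hv.
by split=> //; apply/(act bv av).
Qed.

Lemma fill_cross h v x y : admissible e0 C xi h -> h v = Some x ->
  free_before e0 C h (C v) y -> ~ ((v < y /\ y < x) \/ (x < y /\ y < v)).
Proof.
move=> ad /(admissible_some ad)[_ _ [n [e [_ H]]]] fy side.
have [|m mn em] := @walk_cross v n y; first by rewrite e; lia.
apply: (H m); last by rewrite em.
by rewrite ltn_neqAle mn andbT; apply/eqP => mne; rewrite mne in em; lia.
Qed.

Lemma free_before_le h s s' x : s <= s' -> free_before e0 C h s' x ->
  free_before e0 C h s x.
Proof.
move=> le [hx H]; split=> // -[u [hu cu]]; apply: H; exists u; split=> //.
exact: lt_le_trans le.
Qed.

Lemma not_free h s x : e0 x = Hole -> ~ free_before e0 C h s x -> filled_before h s x.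
Proof. by move=> hx nf; apply: contrapT => no; apply: nf; split. Qed.

Definition filled_tail h s := exists b M, forall x, beyond b M x -> e0 x = Hole ->
  filled_before h s x.

(** Let [v] fill the last hole of a block inside the tail. If there were no filled tail at time
    [C v], free holes on both sides of the block would confine the fillers of all holes between
    them, and this matching would contradict the block. *)
Lemma filled_tail_earlier h t : t < 1 -> admissible e0 C xi h -> filled_tail h t ->
  exists v x, [/\ h v = Some x, C v < t & filled_tail h (C v)].
Proof.
move=> t1 ad [b [M HM]]; have [p [q [[pq blk] bey]]] := block_exists b M t1.
have allf x : p <= x -> x <= q -> e0 x = Hole -> filled_before h t x.
  by move=> px xq; apply: HM; apply: bey.
have [v [x [hv px xq cv vmax]]] : exists v x, [/\ h v = Some x, p <= x, x <= q, C v < t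
    & forall v' x', h v' = Some x' -> p <= x' -> x' <= q -> C v' < t -> C v' <= C v].
  (* The latest fill time is found as a minimum of opposites; the default [0] is harmless because
     the search is restricted to filled holes. *)
  have [|x [xr [hx [v [hv cv]]] vmax]] := @seq_argmin _ _ 
     (fun x => - (match pselect (filled_before h t x) with
        left H => C (projT1 (cid H)) | right _ => 0 end)) (irange p (absz (q - p + 1)%R))
     (fun x => e0 x = Hole /\ filled_before h t x).
    (* A block contains a hole, as otherwise the empty matching would do. *)
    apply: contrapT => no; have := blk (p - 1) (q + 1).
    suff : pot t (q + 1) - pot t (p - 1 + 1) <= 0 by lia.
    apply: (@pot_le_of_matching _ _ _ (fun _ _ => False)) => //; first by lia.
    move=> x x1 x2 hx; case: no; exists x; first by rewrite mem_irange; lia.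
    by split=> //; apply: allf => //; lia.
  have key x' v' : h v' = Some x' -> C v' < t ->
    (match pselect (filled_before h t x') with
        left H => C (projT1 (cid H)) | right _ => 0 end) = C v'.
    move=> hv' cv'; case: pselect => [H|[]]; last by exists v'.
    case: (cid H) => v'' [hv'' cv''] /=.
    have [_ _ [_ [_ [[_ n1] _]]]] := admissible_some ad hv'.
    have [_ _ [_ [_ [[_ n2] _]]]] := admissible_some ad hv''.
    apply/eqP; rewrite eq_le !leNgt; apply/andP; split; apply/negP => lt.
      by apply: n2; exists v'.
    by apply: n1; exists v''.
  exists v, x; move: xr; rewrite mem_irange => xr; split=> //; try lia.
  move=> v' x' hv' px' xq' cv'; rewrite -lerN2 -(key x v) // -(key x' v') //.
  have [_ _ [_ [_ [[hx' _] _]]]] := admissible_some ad hv'.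
  apply: vmax; first by rewrite mem_irange; lia.
  by split=> //; exists v'.
exists v, x; split=> //; apply: contrapT => nt.
have tail b' M' : exists y, beyond b' M' y /\ free_before e0 C h (C v) y.
  apply: contrapT => no; apply: nt; exists b', M' => y by' hy.
  by apply: not_free => // fy; apply: no; exists y.
have [|y [yp fy ymax]] := @int_max_below (free_before e0 C h (C v)) p.
  by have [y [y1 y2]] := tail true p; exists y.
have [|z [zq fz zmin]] := @int_min_above (free_before e0 C h (C v)) q.
  by have [c [c1 c2]] := tail false q; exists c.
have := blk y z yp zq; suff : pot t z - pot t (y + 1) <= 0 by lia.
have yz : y < z by lia.
apply: (@pot_le_of_matching _ _ _ (fun u x => h u = Some x)) => //; last first.
- by move=> u a c ha hc; rewrite ha in hc; case: hc.
- move=> a ya az ha.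
  have [u [hu cu]] : exists u, h u = Some a /\ C u <= C v.
    have [pa|ap] := leP p a; last first.
      have [|u [hu cu]] := @not_free h (C v) a ha; first exact: ymax.
      by exists u; split=> //; exact: ltW.
    have [aq|qa] := leP a q; last first.
      have [|u [hu cu]] := @not_free h (C v) a ha; first exact: zmin.
      by exists u; split=> //; exact: ltW.
    have [u [hu cu]] := allf a pa aq ha; exists u; split=> //.
    exact: vmax hu pa aq cu.
  have [bu _ _] := admissible_some ad hu.
  have aux s : free_before e0 C h (C v) s ->
      u <> s /\ ~ ((u < s /\ s < a) \/ (a < s /\ s < u)).
    move=> fs; split; last exact: fill_cross ad hu (free_before_le cu fs).
    by move=> us; case: fs => hs _; rewrite us hs in bu.
  have := aux y fy; have := aux z fz => auxz auxy.
  by exists u; split=> //; [lia|lia|exact: le_trans (ltW cv)].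
Qed.

Lemma filler_unique h u v x : admissible e0 C xi h -> h u = Some x -> h v = Some x -> u = v.
Proof.
move=> ad hu hv; apply: clock_inj.
have [_ _ [_ [_ [[_ nu] _]]]] := admissible_some ad hu.
have [_ _ [_ [_ [[_ nv] _]]]] := admissible_some ad hv.
apply/eqP; rewrite eq_le !leNgt; apply/andP; split; apply/negP => lt.
  by apply: nu; exists v.
by apply: nv; exists u.
Qed.

(** Each new ball is taken so that the others lie beyond it, which makes them distinct. *)
Lemma many_balls_seq s s' b n M : 0 < s -> s < s' -> s' < 1 ->
  exists l : seq int, [/\ uniq l, size l = n & forall v, v \in l ->
    [/\ beyond b M v, e0 v = Ball, s < C v & C v < s']].
Proof.
move=> s0 ss s1; elim: n M => [|n IH] M; first by exists [::].
have [v [bv Bv c1 c2]] := many_balls s0 ss s1 b M.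
have [l [ul sl Hl]] := IH v; exists (v :: l); split.
- rewrite /= ul andbT; apply/negP => /Hl[+ _ _ _].
  by rewrite /beyond; case: (b); lia.
- by rewrite /= sl.
- move=> u; rewrite inE => /orP[/eqP ->//|/Hl[bu Bu d1 d2]]; split=> //.
  by move: bu bv; rewrite /beyond; case: (b); lia.
Qed.

(* Otherwise infinitely many balls would be released behind the filled half-line
   between the two fill times, and all of them must stop before [x0]. *)
Lemma no_filled_tail h t : t < 1 -> admissible e0 C xi h -> ~ filled_tail h t.
Proof.
move=> t1 ad /(filled_tail_earlier t1 ad)[v0 [x0 [h0 c0 tl0]]].
have c01 : C v0 < 1 by exact: lt_trans t1.
have [v1 [x1 [h1 c1 [b [M HM]]]]] := filled_tail_earlier c01 ad tl0.
have [B0 act0 [n0 [e0' [[hx0 nx0] _]]]] := admissible_some ad h0.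
have nbx0 : ~ beyond b M x0.
  by move=> /HM /(_ hx0)[u [hu cu]]; apply: nx0; exists u; split=> //; apply: lt_trans c1.
(* The balls of the half-line cannot pass [x0], which is free until [C v0], and the holes beyond [M]
   are filled already; [tgt] contains all that is left. *)
pose tgt := irange (Num.min M x0) (absz (x0 - M)%R).+1.
have [l [ul sl Hl]] := many_balls_seq b (size tgt).+1 M (clock_gt0 v1) c1 c01.
suff : (size l <= size tgt)%N by rewrite sl ltnn.
apply: (@inj_size_le _ _ _ (fun y v => h v = Some y)) => //; last first.
  by move=> y u v hu hv; apply: filler_unique hu hv.
move=> v /Hl[bv Bv d1 d2].
have actv : active e0 C xi h v.
  by move=> [u [fu cu]]; apply: act0; exists u; split=> //; apply: lt_trans d2.
have [y hy] : exists y, h v = Some y.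
  case hv : (h v) => [y|]; first by exists y.
  (* A ball that finds no hole would freeze the process before the clock of [v0], which is
     active. *)
  exfalso; apply: act0; exists v; split=> //; do 2![split=> //] => n fn.
  have [k [fk kmin]] := @nat_argmin (fun n => free_before e0 C h (C v) (w v n))
    (ex_intro _ n fn).
  have [_ [/(_ Bv actv (w v k)) [_ H] _]] := ad v.
  by rewrite H in hv => //; exists k.
exists y => //.
have [_ _ [n [en [[hy' ny] _]]]] := admissible_some ad hy.
have nby : ~ beyond b M y.
  by move=> /HM /(_ hy')[u [hu cu]]; apply: ny; exists u; split=> //; apply: lt_trans d1.
have yx0 : y <> x0 by move=> yx; apply: nx0; exists v; rewrite -yx.
have fx0 : free_before e0 C h (C v) x0.
  by apply: (free_before_le (ltW d2)); split.
have := fill_cross ad hy fx0; rewrite mem_irange.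
by move: bv nbx0 nby; rewrite /beyond; case: (b); lia.
Qed.

Lemma free_exists h t b M : t < 1 -> admissible e0 C xi h ->
  exists x, beyond b M x /\ free_before e0 C h t x.
Proof.
move=> t1 ad; apply: contrapT => no; apply: (no_filled_tail t1 ad).
exists b, M => x bx hx; apply: not_free => // fx; apply: no; by exists x.
Qed.

Lemma admissible_active h v : admissible e0 C xi h -> active e0 C xi h v.
Proof.
move=> ad [u [fu _]]; apply: (@no_freezer_of_free h u) fu => b M.
exact: free_exists.
Qed.

(** Holes that [h] leaves free until just after [C v] cut out a finite interval, on which clock
    induction works: the holes that [u] passes under [h] are already filled under [h'], so under
    [h'] the ball of [u] fills [a] unless an earlier ball did. *)
Lemma admissible_dominated h h' v x : admissible e0 C xi h -> admissible e0 C xi h' ->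
  h v = Some x -> exists u, h' u = Some x /\ C u <= C v.
Proof.
move=> ad ad'; have [t vt t1] := clock_gap v => hv.
have [y [y1 fy]] := free_exists true (Num.min v x) t1 ad.
have [z [z1 fz]] := free_exists false (Num.max v x) t1 ad.
rewrite /beyond in y1 z1; have yz : y < z by lia.
have inside u a : h u = Some a -> C u < t -> (y < a < z) -> (y < u < z).
  move=> hu cu; have [bu _ _] := admissible_some ad hu.
  have aux s : free_before e0 C h t s ->
      u <> s /\ ~ ((u < s /\ s < a) \/ (a < s /\ s < u)).
    move=> fs; split; last exact: fill_cross ad hu (free_before_le (ltW cu) fs).
    by move=> us; case: fs => hs _; rewrite us hs in bu.
  by have := aux y fy; have := aux z fz; lia.
suff : forall u, u \in between y z -> C u < t -> forall a, y < a < z -> h u = Some a ->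
    exists u', h' u' = Some a /\ C u' <= C u.
  by move/(_ v) => H; apply: H => //; [rewrite mem_between //|]; lia.
apply: (@seq_clock_ind _ _ C) => u; rewrite mem_between // => uyz IH cu a ayz hu.
apply: contrapT => no.
have [bu _ [n [en [[ha na] Hn]]]] := admissible_some ad hu.
have fa' : free_before e0 C h' (C u) a.
  by split=> // -[u' [hu' cu']]; apply: no; exists u'; split=> //; exact: ltW.
have [_ [/(_ bu (admissible_active ad') a) [_ H] _]] := ad' u.
apply: no; exists u; split=> //; apply: H; exists n; do 2![split=> //].
move=> m mn [hm nm].
have [u1 [hu1 cu1]] := not_free hm (Hn m mn).
apply: nm.
have myz : y < w u m < z.
  have aux s : free_before e0 C h t s -> (s <= u /\ w u m <= s) \/ (u <= s /\ s <= w u m) -> False.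
    move=> fs side; have [|k km ek] := @walk_cross u m s; first by lia.
    apply: (Hn k); first exact: leq_ltn_trans mn.
    by rewrite ek; apply: free_before_le fs; exact: ltW.
  by have := aux y fy; have := aux z fz; lia.
have [||u2 [hu2 cu2]] := IH u1 _ cu1 _ _ myz hu1.
- by rewrite mem_between //; apply: inside hu1 _ myz; apply: lt_trans cu.
- exact: lt_trans cu.
by exists u2; split=> //; apply: le_lt_trans cu1.
Qed.

(** Domination in both directions gives the same free holes at every clock, hence the same first
    free hole. *)
Lemma admissible_unique h h' : admissible e0 C xi h -> admissible e0 C xi h' -> h = h'.
Proof.
have sub g g' v x : admissible e0 C xi g -> admissible e0 C xi g' ->
    g v = Some x -> g' v = Some x.
  move=> ad ad' gv; have [bv av [n [en [[hx nx] H]]]] := admissible_some ad gv.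
  have [_ [/(_ bv (admissible_active ad') x) [_ K] _]] := ad' v; apply: K.
  exists n; do 2![split=> //].
    split=> // -[u [hu cu]]; have [u' [hu' cu']] := admissible_dominated ad' ad hu.
    by apply: nx; exists u'; split=> //; apply: le_lt_trans cu.
  move=> m mn [hm nm]; apply: (H m mn); split=> // -[u [hu cu]].
  have [u' [hu' cu']] := admissible_dominated ad ad' hu.
  by apply: nm; exists u'; split=> //; apply: le_lt_trans cu.
move=> ad ad'; apply/funext => v.
case e : (h v) => [x|]; first by apply/esym; apply: sub e.
by case e' : (h' v) => [x|] //; rewrite -e; apply/esym; rewrite (sub _ _ _ _ ad' ad e').
Qed.
End Uniqueness.

End Dynamics.

(** * Deterministic consequences on good realizations *)

Section Good.
Variables (R : realType) (e0 : int -> site) (C : int -> R) (xi : int -> nat -> int).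
Hypothesis xi_unit : forall v k, xi v k = 1 \/ xi v k = -1.

Local Notation w := (walk xi).
Local Notation drift := (drift e0 C).
Local Notation pot := (pot e0 C).
Local Notation reachable := (reachable e0 C xi).
Local Notation fills := (fills e0 C xi).
Local Notation history := (history e0 C xi).

Definition clocks_ok := (forall v, 0 < C v < 1) /\ (forall u v, C u = C v -> u = v).

(** Only countably many times, accumulating at [1], and integer levels are used, so that null sets
    can be summed. Divergence of the sums over [Negz] sends the potential to minus infinity on the
    left. *)
Definition sums_diverge := forall k : nat, forall K : int, exists N : nat, forall n,
  (N <= n)%N -> K < \sum_(i < n) drift (1 - k.+1%:R^-1) (Posz i) /\
                K < \sum_(i < n) drift (1 - k.+1%:R^-1) (Negz i).

Definition balls_everywhere := forall q q' : rat, 0 < q -> q < q' -> q' < 1 ->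
  forall (b : bool) (M : int), exists v,
    [/\ beyond b M v, e0 v = Ball, ratr q < C v & C v < ratr q'].

(** Configurations without balls are kept apart: they are the typical ones when [rb = 0], where
    [balls_everywhere] fails and [rh] may vanish as well. *)
Definition good := [/\ clocks_ok, forall v (M : nat), exists n, (M <= absz (w v n))%N &
  (forall v, e0 v <> Ball) \/ (sums_diverge /\ balls_everywhere)].

Lemma drift_antitone t t' x : t <= t' -> drift t' x <= drift t x.
Proof.
move=> tt; rewrite /drift; case: (e0 x) => //.
case: (leP (C x) t') => c; case: (leP (C x) t) => c' //.
by have := lt_le_trans c (le_trans c' tt); rewrite ltxx.
Qed.

(** The drift decreases with time, so divergence at some [1 - 1/(k+1)] above [t] is enough. *)
Lemma sums_diverge_pot : sums_diverge -> forall t, t < 1 -> forall K,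
  (exists N, forall z, N <= z -> K < pot t z) /\ (exists N, forall z, z <= N -> pot t z < K).
Proof.
move=> sd t t1 K.
have [k tk] : exists k : nat, t <= 1 - k.+1%:R^-1.
  have d0 : 0 < 1 - t by rewrite subr_gt0.
  have [k _ Hk] := near_infty_natSinv_lt (PosNum d0).
  exists k; have h : k.+1%:R^-1 < 1 - t := Hk k (leqnn k).
  by rewrite lerBrDr addrC -lerBrDr ltW.
have le (f : nat -> int) n : \sum_(i < n) drift (1 - k.+1%:R^-1) (f i) <= \sum_(i < n) drift t (f i).
  by apply: ler_sum => i _; apply: drift_antitone.
split.
  have [N HN] := sd k K; exists N%:Z => -[n|n]; last by lia.
  move=> Nn; apply: lt_le_trans (le (fun i => Posz i) n); apply: (HN n _).1; lia.
have [N HN] := sd k (- K); exists (- N%:Z) => -[n|n] Nn.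
  (* Among the nonnegative sites only [0] can occur here, with [N = 0]; the empty sum then gives
     [0 < K]. *)
  have N0 : N = 0%N by lia.
  have n0 : n = 0%N by lia.
  have := (HN 0%N _).1; rewrite N0 n0 => /(_ isT); rewrite /= !big_ord0; lia.
have h : - K < \sum_(i < n.+1) drift t (Negz i).
  by apply: lt_le_trans (le Negz n.+1); apply: (HN n.+1 _).2; lia.
by rewrite /= ltrNl.
Qed.

Lemma balls_everywhere_real : balls_everywhere ->
  forall s s', 0 < s -> s < s' -> s' < 1 -> forall b M,
  exists v, [/\ beyond b M v, e0 v = Ball, s < C v & C v < s'].
Proof.
move=> be s s' s0 ss s1 b M.
have [q] := rat_in_itvoo ss; rewrite in_itv /= => /andP[sq qs].
have [q'] := rat_in_itvoo qs; rewrite in_itv /= => /andP[qq q's].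
have [|||v [bv Bv c1 c2]] := be q q' _ _ _ b M.
- by rewrite -(ltr0q R); apply: lt_trans sq.
- by rewrite -(ltr_rat R).
- by rewrite -(ltr_rat R) rmorph1; apply: lt_trans s1.
exists v; split=> //; [exact: lt_trans c1|exact: lt_trans q's].
Qed.

Lemma no_ball_reachable v x : (forall v, e0 v <> Ball) -> ~ reachable v x.
Proof. by move=> nb /reachable_inv[/nb]. Qed.

Lemma good_history : good -> [/\ admissible e0 C xi history,
  forall u, ~ freezer e0 C xi history u &
  forall h, admissible e0 C xi h -> h = history].
Proof.
move=> [[c01 cinj] wu [nb|[sd be]]].
  have hN v : history v = None.
    case e : (history v) => [x|] //.
    by move/historyP: e => -[/(no_ball_reachable nb)].
  split=> [v|u [/nb]//|h ad]; last first.
    by apply/funext => v; rewrite hN; have [/(_ (nb v))] := ad v.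
  by split=> //; split=> /nb.
have c1 v : C v < 1 by have /andP[] := c01 v.
have c0 v : 0 < C v by have /andP[] := c01 v.
have pp t : t < 1 -> forall K, exists N, forall z, N <= z -> K < pot t z.
  by move=> t1 K; have [] := sums_diverge_pot sd t1 K.
have pn t : t < 1 -> forall K, exists N, forall z, z <= N -> pot t z < K.
  by move=> t1 K; have [] := sums_diverge_pot sd t1 K.
have hadm : admissible e0 C xi history by exact: history_admissible.
split=> // [u|h ad]; first exact: history_no_freezer.
by apply: admissible_unique => //; [exact: pp|exact: pn|exact: balls_everywhere_real].
Qed.

(** On a good realization a site changes at most once, and then to [Neut]; [u] is the ball whose
    clock is the time of this change, by leaving [x] or by filling it. *)
Definition jump (u x : int) := (e0 x = Ball /\ u = x) \/ fills u x.

Lemma jump_unique u v x : good -> jump u x -> jump v x -> u = v.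
Proof.
move=> gd; have [ad _ _] := good_history gd; case: gd => -[_ cinj] _ _.
move=> [[bx ->]|fu] [[bx' ->]|fv] //.
- by case: fv => /reachable_inv[_ hx]; rewrite hx in bx.
- by case: fu => /reachable_inv[_ hx]; rewrite hx in bx'.
- move/historyP: fu => fu; move/historyP: fv => fv.
  exact: filler_unique cinj _ _ _ _ ad fu fv.
Qed.

Lemma good_path : good -> golf_path e0 C xi = fun t x =>
  if `[< exists u, jump u x /\ C u <= t >] then Neut else e0 x.
Proof.
move=> gd; have [ad nf un] := good_history gd.
rewrite /golf_path; case: pselect => [H|[]]; last by exists history.
case: (cid H) => h ah /=; rewrite (un h ah) => {h ah H}.
apply/funext => t; apply/funext => x; rewrite /traj.
case: asboolP => [[u [/nf]//]|_].
have nofill : e0 x <> Hole -> forall u, ~ fills u x.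
  by move=> nh u [/reachable_inv[_ hx]].
case e : (e0 x).
- congr (if _ then _ else _); apply/asboolP/asboolP => -[u [hu cu]]; exists u; split=> //.
    by right; apply/historyP.
  by case: hu => [[]|/historyP//]; rewrite e.
- by case: asboolP.
- have -> : `[< exists u, jump u x /\ C u <= t >] = (C x <= t); last by [].
  apply/asboolP/idP => [[u [hu cu]]|cx]; last by exists x; split=> //; left.
  by case: hu => [[_ <-]//|/nofill]; rewrite e; case.
- case: asboolP => // -[u [hu cu]]; exfalso.
  by case: hu => [[]|/nofill]; rewrite e //; apply.
Qed.

Lemma good_well_defined : good -> well_defined e0 C xi.
Proof.
move=> /good_history[ad _ un]; exists history; split=> // h ah.
by rewrite (un h ah).
Qed.

Lemma good_not_frozen t : good -> not_frozen_at e0 C xi t.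
Proof. by move=> /good_history[_ nf un] h /un -> [u [/nf]]. Qed.

Definition window (n : nat) : seq int := irange (- n%:Z) (n + n).+1.

Lemma mem_window n x : (x \in window n) = (absz x <= n)%N.
Proof. rewrite mem_irange; apply/idP/idP; lia. Qed.

Lemma seq_min_pos (I : eqType) (s : seq I) (F : I -> R -> Prop) :
  (forall i d d', d' <= d -> F i d -> F i d') ->
  (forall i, i \in s -> exists2 d, 0 < d & F i d) ->
  exists2 d, 0 < d & forall i, i \in s -> F i d.
Proof.
move=> mono; elim: s => [|a s IH] H; first by exists 1.
have [|d d0 Hd] := IH; first by move=> i si; apply: H; rewrite inE si orbT.
have [d' d'0 Hd'] := H a (mem_head _ _).
exists (Num.min d d'); first by rewrite lt_min d0.
move=> i; rewrite inE => /orP[/eqP ->|si].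
  by apply: mono Hd'; rewrite ge_min lexx orbT.
by apply: mono (Hd i si); rewrite ge_min lexx.
Qed.

(** A window has finitely many sites with at most one jump each, so some positive time separates [t]
    from the next jumps, and likewise from the previous ones. *)
Lemma good_cadlag : good -> cadlag (golf_path e0 C xi).
Proof.
move=> gd; rewrite (good_path gd).
have uniq_jump u v x : jump u x -> jump v x -> u = v by exact: jump_unique.
split=> t t0 t1.
  move=> n; have [||d d0 Hd] := @seq_min_pos _ (window n)
     (fun x d => forall u, jump u x -> t < C u -> t + d <= C u).
  - move=> x d d' dd H u ju tu; apply: le_trans (H u ju tu); lra.
  - move=> x _; have [[u [ju tu]]|no] := pselect (exists u, jump u x /\ t < C u).
      exists (C u - t); first by rewrite subr_gt0.
      by move=> v jv _; rewrite (uniq_jump _ _ _ jv ju); lra.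
    by exists 1 => // u ju tu; case: no; exists u.
  exists d => // s ts sd s1 x; rewrite -mem_window => xn.
  congr (if _ then _ else _); apply/asboolP/asboolP => -[u [ju cu]]; exists u; split=> //.
    rewrite leNgt; apply/negP => tu; have := Hd x xn u ju tu; lra.
  exact: le_trans ts.
(* The left limit counts only the jumps strictly before [t]. *)
exists (fun x => if `[< exists u, jump u x /\ C u < t >] then Neut else e0 x) => n.
have [||d d0 Hd] := @seq_min_pos _ (window n)
     (fun x d => forall u, jump u x -> C u < t -> C u <= t - d).
- move=> x d d' dd H u ju tu; apply: le_trans (H u ju tu) _; lra.
- move=> x _; have [[u [ju tu]]|no] := pselect (exists u, jump u x /\ C u < t).
    exists (t - C u); first by rewrite subr_gt0.
    by move=> v jv _; rewrite (uniq_jump _ _ _ jv ju); lra.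
  by exists 1 => // u ju tu; case: no; exists u.
exists d => // s ts st s0 x; rewrite -mem_window => xn.
congr (if _ then _ else _); apply/asboolP/asboolP => -[u [ju cu]]; exists u; split=> //.
  exact: le_lt_trans st.
have := Hd x xn u ju cu; lra.
Qed.

End Good.

(** * Time changes *)

Section TimeChange.
Variable R : realType.

(** The maps live on the whole line, so that they compose freely; [[0, 1]] matters only in
    [time_change_exists]. *)
Definition shift_in (q r : R) (lam : R -> R) :=
  [/\ {homo lam : x y / x < y}, continuous lam,
   forall x, x <= q \/ r <= x -> lam x = x &
   forall x, q < x < r -> q < lam x < r].

(** The map is piecewise linear through [(q, q)], [(s, t)] and [(r, r)], with slopes [a >= 1] and
    [b <= 1]. The minimum of the two lines lies above the diagonal inside the interval and below it
    outside, so the maximum with the identity gives the map. *)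
Lemma shift_up (q s t r : R) : q < s -> s <= t -> t < r ->
  exists2 lam, shift_in q r lam & lam s = t.
Proof.
move=> qs st tr.
pose a := (t - q) / (s - q); pose b := (r - t) / (r - s).
have a1 : 1 <= a by rewrite ler_pdivlMr; lra.
have b0 : 0 < b by rewrite divr_gt0 //; lra.
have b1 : b <= 1 by rewrite ler_pdivrMr; lra.
have as_ : (s - q) * a = t - q by rewrite mulrC divfK //; lra.
have bs : (r - s) * b = r - t by rewrite mulrC divfK //; lra.
exists (fun x => Num.max x (Num.min (q + (x - q) * a) (r - (r - x) * b))); last first.
  rewrite as_ bs; have -> : q + (t - q) = t by ring.
  have -> : r - (r - t) = t by ring.
  by rewrite minxx max_r.
split.
- move=> x y xy; rewrite gt_max !lt_max xy /= lt_min !gt_min; apply/orP; right.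
  by apply/andP; split; apply/orP; [left|right]; nra.
- move=> x; apply: (@continuous_max R R (fun x => x)); first exact: cvg_id.
  apply: (@continuous_min R R (fun x => q + (x - q) * a)).
    apply: cvgD; first exact: cvg_cst.
    by apply: cvgM; [apply: cvgB; [exact: cvg_id|exact: cvg_cst]|exact: cvg_cst].
  apply: cvgB; first exact: cvg_cst.
  by apply: cvgM; [apply: cvgB; [exact: cvg_cst|exact: cvg_id]|exact: cvg_cst].
- move=> x [xq|rx]; apply: max_l; rewrite ge_min; apply/orP; [left|right]; nra.
- move=> x /andP[qx xr]; rewrite lt_max qx /= gt_max xr gt_min /=.
  by apply/orP; right; nra.
Qed.

(** A shift downwards is a shift upwards conjugated by the reflection of the line. *)
Lemma shift_exists (q s t r : R) : q < s < r -> q < t < r ->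
  exists2 lam, shift_in q r lam & lam s = t.
Proof.
move=> /andP[qs sr] /andP[qt tr]; have [st|ts] := leP s t; first exact: shift_up.
have [|||lam [mono cont out ins] ls] := @shift_up (- r) (- s) (- t) (- q); try lra.
exists (fun x => - lam (- x)); last by rewrite ls opprK.
split.
- by move=> x y xy; rewrite ltrN2; apply: mono; rewrite ltrN2.
- move=> x; apply: (@continuous_comp _ _ _ (fun x => lam (- x)) (fun y => - y)).
    by apply: (@continuous_comp _ _ _ (fun y => - y) lam); [exact: opp_continuous|exact: cont].
  exact: opp_continuous.
- by move=> x H; rewrite out ?opprK //; case: H => H; [right|left]; rewrite lerN2.
- by move=> x H; have := ins (- x); rewrite !ltrN2 andbC => /(_ H); lra.
Qed.

(** The shifts are composed; on disjoint intervals each one is the identity where another acts. *)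
Lemma shifts_exist (I : eqType) (U : seq I) (q r s t : I -> R) : uniq U ->
  (forall u, u \in U -> q u < s u < r u) -> (forall u, u \in U -> q u < t u < r u) ->
  (forall u v, u \in U -> v \in U -> u <> v -> r u <= q v \/ r v <= q u) ->
  exists lam, [/\ {homo lam : x y / x < y}, continuous lam,
    forall u, u \in U -> lam (s u) = t u,
    forall x, (forall u, u \in U -> ~ q u < x < r u) -> lam x = x &
    forall u x, u \in U -> q u < x < r u -> q u < lam x < r u].
Proof.
elim: U => [|u U IH] /=.
  move=> _ _ _ _; exists id; split=> // x; exact: cvg_id.
move=> /andP[uU unU] Hs Ht Hd.
have inU v : v \in U -> v \in u :: U by rewrite inE => ->; rewrite orbT.
have uU' : u \in u :: U := mem_head _ _.
have [lam [mono cont ls out ins]] : exists lam, [/\ {homo lam : x y / x < y}, continuous lam,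
    forall u, u \in U -> lam (s u) = t u,
    forall x, (forall u, u \in U -> ~ q u < x < r u) -> lam x = x &
    forall u x, u \in U -> q u < x < r u -> q u < lam x < r u].
  apply: IH => //; [by move=> v /inU/Hs|by move=> v /inU/Ht|].
  by move=> v v' /inU vU /inU v'U; apply: Hd.
have [mu [mmono mcont mout mins] mus] := shift_exists (Hs u uU') (Ht u uU').
have disj v x : v \in U -> q u < x < r u -> ~ q v < x < r v.
  move=> vU xu xv; have uv : u <> v by move=> uv; rewrite uv vU in uU.
  by case: (Hd u v uU' (inU v vU) uv); lra.
have muid v x : v \in U -> q v < x < r v -> mu x = x.
  move=> vU xv; apply: mout; have uv : u <> v by move=> uv; rewrite uv vU in uU.
  by case: (Hd u v uU' (inU v vU) uv); [right|left]; lra.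
exists (lam \o mu); split.
- by move=> x y xy; apply: mono; apply: mmono.
- by move=> x; apply: continuous_comp; [exact: mcont|exact: cont].
- move=> v; rewrite inE => /orP[/eqP ->|vU] /=; last by rewrite (muid v) ?ls //; apply/Hs/inU.
  rewrite mus out // => v' v'U; apply: disj => //; exact: Ht.
- move=> x H /=; have mx : mu x = x.
    apply: mout; have /negP := H u uU'; rewrite negb_and -!leNgt => /orP[]; tauto.
  by rewrite mx out // => v /inU; exact: H.
- move=> v x; rewrite inE => /orP[/eqP ->|vU] xv /=.
    have mx := mins _ xv; rewrite out // => v' v'U; exact: disj mx.
  by rewrite (muid v) //; apply: ins.
Qed.

Lemma time_change_exists (I : eqType) (U : seq I) (q r s t : I -> R) (e : R) : uniq U -> 0 < e ->
  (forall u, u \in U -> [/\ 0 <= q u, q u < s u < r u, q u < t u < r u, r u <= 1 & r u - q u < e]) ->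
  (forall u v, u \in U -> v \in U -> u <> v -> r u <= q v \/ r v <= q u) ->
  exists lam, [/\ time_change lam, forall x, `|lam x - x| < e,
     {homo lam : x y / x < y} &
     forall u, u \in U -> lam (s u) = t u].
Proof.
move=> uU e0 H Hd.
have [||lam [mono cont ls out ins]] := @shifts_exist I U q r s t uU _ _ Hd.
- by move=> u /H[].
- by move=> u /H[].
exists lam; split=> //.
  split; first by move=> x y _ xy _; exact: mono.
  split; first by apply: out => u /H[] *; lra.
  split; first by apply: out => u /H[] *; lra.
  exact: continuous_subspaceT.
move=> x; have [[u [Uu xu]]|no] := pselect (exists u, u \in U /\ q u < x < r u).
  by have := ins u x Uu xu; have [_ _ _ _ re] := H u Uu; rewrite ltr_norml; lra.
by rewrite out ?subrr ?normr0 // => u Uu xu; apply: no; exists u.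
Qed.

(** A radius [d] is taken at most half the distance between any two clocks, at most their distances
    to [0] and [1], and below [e / 2]. Rational end points keep the codes countable. *)
Lemma separating_intervals (U : seq int) (C : int -> R) (e : R) : 0 < e ->
  (forall u, 0 < C u < 1) -> (forall u v, C u = C v -> u = v) ->
  exists q r : int -> rat, (forall u, u \in U ->
    [/\ 0 <= (ratr (q u) : R), ratr (q u) < C u < ratr (r u), ratr (r u) <= (1 : R) &
        ratr (r u) - ratr (q u) < e]) /\
   (forall u v, u \in U -> v \in U -> u <> v ->
     ratr (r u) <= (ratr (q v) : R) \/ ratr (r v) <= (ratr (q u) : R)).
Proof.
move=> e0 c01 cinj.
pose F (p : int * int) (d : R) := [/\ d <= C p.1, d <= 1 - C p.1, d < e / 2 &
   p.1 <> p.2 -> d + d <= `|C p.1 - C p.2|].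
have [||d d0 Hd] := @seq_min_pos R _ (allpairs pair U U) F.
- move=> [u v] d d' dd [/= h1 h2 h3 h4]; split=> /=; try lra.
  by move=> uv; have := h4 uv; lra.
- move=> [u v] _; have /andP[cu0 cu1] := c01 u.
  pose g := if u == v then 1 else `|C u - C v|.
  have g0 : 0 < g.
    rewrite /g; case: eqP => // uv; rewrite normr_gt0 subr_eq0; apply/eqP => cc.
    by apply: uv; apply: cinj.
  exists (Num.min (Num.min (C u) (1 - C u)) (Num.min (e / 4) (g / 2))).
    by rewrite !lt_min; apply/andP; split; apply/andP; split; lra.
  split => /=; rewrite ?ge_min ?gt_min; try (rewrite lexx ?orbT //).
    have : e / 4 < e / 2 by lra. by move=> ->; rewrite !orbT.
  move=> uv; set m := Num.min _ _; have : m <= g / 2 by rewrite /m !ge_min lexx !orbT.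
  by rewrite /g; move/eqP/negbTE: uv => ->; lra.
have ql u : exists q : rat, C u - d < ratr q < C u.
  have [|q] := @rat_in_itvoo R (C u - d) (C u); first by lra.
  by rewrite in_itv; exists q.
have rl u : exists q : rat, C u < ratr q < C u + d.
  have [|q] := @rat_in_itvoo R (C u) (C u + d); first by lra.
  by rewrite in_itv; exists q.
have [q Hq] := choice ql; have [r Hr] := choice rl.
exists q, r; split.
  move=> u Uu; have [|/= h1 h2 h3 _] := Hd (u, u); first exact: allpairs_f.
  by have /andP[? ?] := Hq u; have /andP[? ?] := Hr u; split; lra.
move=> u v Uu Uv uv; have [|/= _ _ _ /(_ uv)] := Hd (u, v); first exact: allpairs_f.
have /andP[? ?] := Hq u; have /andP[? ?] := Hr u.
have /andP[? ?] := Hq v; have /andP[? ?] := Hr v.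
have [cc|cc] := leP (C u) (C v).
  by rewrite ler0_norm ?subr_le0 // => h; left; lra.
by rewrite gtr0_norm ?subr_gt0 // => h; right; lra.
Qed.

End TimeChange.

(** * Measurability *)

Section Measurability.
Context d (T : measurableType d) (R : realType).

Lemma measurable_set_not (Q : T -> Prop) :
  measurable [set w | Q w] -> measurable [set w | ~ Q w].
Proof. by move=> mQ; have := measurableC mQ. Qed.

Lemma measurable_set_and (Q S : T -> Prop) : measurable [set w | Q w] ->
  measurable [set w | S w] -> measurable [set w | Q w /\ S w].
Proof. by move=> mQ mS; have := measurableI _ _ mQ mS. Qed.

Lemma measurable_set_or (Q S : T -> Prop) : measurable [set w | Q w] ->
  measurable [set w | S w] -> measurable [set w | Q w \/ S w].
Proof. by move=> mQ mS; have := measurableU _ _ mQ mS. Qed.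

Lemma measurable_set_imp (Q S : T -> Prop) : measurable [set w | Q w] ->
  measurable [set w | S w] -> measurable [set w | Q w -> S w].
Proof.
move=> mQ mS; rewrite (_ : [set w | _] = [set w | ~ Q w \/ S w]).
  exact: measurable_set_or (measurable_set_not mQ) mS.
apply/seteqP; split=> w /=; last by case.
by have [q|nq] := pselect (Q w) => h; [right; exact: h|left].
Qed.

Lemma measurable_set_const (Q : Prop) : measurable [set w : T | Q].
Proof.
have [q|nq] := pselect Q.
  by rewrite (_ : [set w : T | Q] = setT) //; apply/seteqP; split.
by rewrite (_ : [set w : T | Q] = set0) //; apply/seteqP; split.
Qed.

Lemma measurable_set_exists (I : countType) (Q : I -> T -> Prop) :
  (forall i, measurable [set w | Q i w]) -> measurable [set w | exists i, Q i w].
Proof.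
move=> mQ; rewrite (_ : [set w | _] = \bigcup_n
    (if (unpickle n : option I) is Some i then [set w | Q i w] else set0)).
  by apply: bigcupT_measurable => n; case: unpickle => [i|//]; exact: mQ.
apply/seteqP; split=> w /=.
  by move=> [i Qi]; exists (pickle i) => //; rewrite pickleK.
by move=> [n _]; case: unpickle => // i Qi; exists i.
Qed.

Lemma measurable_set_forall (I : countType) (Q : I -> T -> Prop) :
  (forall i, measurable [set w | Q i w]) -> measurable [set w | forall i, Q i w].
Proof.
move=> mQ; rewrite (_ : [set w | _] = [set w | ~ exists i, ~ Q i w]).
  by apply: measurable_set_not; apply: measurable_set_exists => i; apply: measurable_set_not.
apply/seteqP; split=> w /= H; first by move=> [i]; apply; exact: H.
by move=> i; apply: contrapT => nQ; apply: H; exists i.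
Qed.

Lemma measurable_ltfun (f g : T -> R) : measurable_fun setT f -> measurable_fun setT g ->
  measurable [set w | f w < g w].
Proof.
move=> mf mg; have := measurable_funB mf mg measurableT (measurable_itv `]-oo, 0[).
rewrite setTI; congr measurable; apply/seteqP; split=> w /=;
  by rewrite in_itv /= subr_lt0.
Qed.

Lemma measurable_eqcst (f : T -> R) (a : R) : measurable_fun setT f ->
  measurable [set w | f w = a].
Proof.
move=> mf; have := mf measurableT _ (measurable_set1 a).
by rewrite setTI.
Qed.

Variables (eta0 clk : int -> T -> R) (step : int -> nat -> T -> R).
Hypothesis meta : forall x, measurable_fun setT (eta0 x).
Hypothesis mclk : forall x, measurable_fun setT (clk x).
Hypothesis mstep : forall v k, measurable_fun setT (step v k).

Local Notation e0 := (init_of eta0).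
Local Notation C := (clocks_of clk).
Local Notation xi := (steps_of step).

Lemma site_ofP (r : R) (s : site) : site_of r = s <->
  match s with Ball => r = 1 | Hole => r = -1 | Neut => r <> 1 /\ r <> -1 | Star => False end.
Proof.
have ne : (1 : R) <> -1 by move=> h; lra.
have ne' : (-1 : R) <> 1 by move=> h; lra.
rewrite /site_of; case: (r =P 1) => [->|n1]; last case: (r =P -1) => [->|n2].
- by case: s; split=> // -[].
- by case: s; split=> // -[].
- by case: s.
Qed.

Lemma measurable_init x s : measurable [set w | e0 w x = s].
Proof.
rewrite (_ : [set w | _] = [set w | match s with Ball => eta0 x w = 1
  | Hole => eta0 x w = -1 | Neut => eta0 x w <> 1 /\ eta0 x w <> -1 | Star => False end]).
  case: s; try exact: measurable_eqcst; last exact: measurable_set_const.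
  by apply: measurable_set_and; apply: measurable_set_not; exact: measurable_eqcst.
by apply/seteqP; split=> w /=; move/site_ofP.
Qed.

Lemma measurable_walk v n x : measurable [set w | walk (xi w) v n = x].
Proof.
elim: n x => [|n IH] x.
  rewrite (_ : [set w | _] = [set w | v = x]); first exact: measurable_set_const.
  by apply/seteqP; split=> w /=; rewrite walk0.
rewrite (_ : [set w | _] = [set w | (step v n w = 1 /\ walk (xi w) v n = x - 1) \/
    (~ step v n w = 1 /\ walk (xi w) v n = x + 1)]).
  apply: measurable_set_or; apply: measurable_set_and => //; first exact: measurable_eqcst.
  by apply: measurable_set_not; exact: measurable_eqcst.
apply/seteqP; split=> w /=; rewrite walkS /steps_of /stepZ.
  by case: eqP => s1 h; [left|right]; split=> //; lia.
by case: eqP => s1 [[]|[]] // _ ->; lia.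
Qed.

Lemma measurable_reach k v x : measurable [set w | reach (e0 w) (C w) (xi w) k v x].
Proof.
elim: k v x => [|k IH] v x /=; first exact: measurable_set_const.
apply: measurable_set_and; first exact: measurable_set_const.
apply: measurable_set_and; first exact: measurable_init.
apply: measurable_set_and; first exact: measurable_init.
apply: measurable_set_exists => n; apply: measurable_set_and; first exact: measurable_walk.
apply: measurable_set_forall => m; apply: measurable_set_imp; first exact: measurable_set_const.
(* The random site of the walk is replaced by a quantifier over fixed sites. *)
rewrite (_ : [set w | _] = [set w | forall y : int, walk (xi w) v m = y -> e0 w y = Hole ->
   exists u, C w u < C w v /\ reach (e0 w) (C w) (xi w) k u y]); last first.
  by apply/seteqP; split=> w /= H; [move=> y <-; exact: H|exact: H].
apply: measurable_set_forall => y; apply: measurable_set_imp; first exact: measurable_walk.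
apply: measurable_set_imp; first exact: measurable_init.
apply: measurable_set_exists => u; apply: measurable_set_and; last exact: IH.
exact: (measurable_ltfun (mclk u) (mclk v)).
Qed.

Lemma measurable_jump u x : measurable [set w | jump (e0 w) (C w) (xi w) u x].
Proof.
have mr v y : measurable [set w | reachable (e0 w) (C w) (xi w) v y].
  by apply: measurable_set_exists => k; exact: measurable_reach.
apply: measurable_set_or; apply: measurable_set_and => //; first exact: measurable_init.
  exact: measurable_set_const.
apply: measurable_set_not; apply: measurable_set_exists => v; apply: measurable_set_and => //.
exact: (measurable_ltfun (mclk v) (mclk u)).
Qed.

(** Natural numbers stand for sites, so that [code] is a countable type. *)
Definition site_index (s : site) : nat :=
  match s with Hole => 0 | Neut => 1 | Ball => 2 | Star => 3 end.

Lemma site_index_inj : injective site_index.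
Proof. by case; case. Qed.

(** Entries are a site, its initial state, and the ball [u] whose clock is the jump time
    of the site, if it jumps, with rational bounds on this clock. *)
Definition code := seq (int * nat * option (int * rat * rat)).

Definition code_cond (a : int * nat * option (int * rat * rat)) (w : T) : Prop :=
  site_index (e0 w a.1.1) = a.1.2 /\
  match a.2 with
  | Some (u, q, r) => jump (e0 w) (C w) (xi w) u a.1.1 /\ ratr q < C w u /\ C w u < ratr r
  | None => forall u, ~ jump (e0 w) (C w) (xi w) u a.1.1
  end.

Definition code_event (c : code) : set T := [set w | forall a, a \in c -> code_cond a w].

Lemma measurable_code_event c : measurable (code_event c).
Proof.
apply: measurable_set_forall => -[[x i] o]; apply: measurable_set_imp; first exact: measurable_set_const.
apply: measurable_set_and => /=.
  rewrite (_ : [set w | _] = [set w | (i = 0%N /\ e0 w x = Hole) \/ (i = 1%N /\ e0 w x = Neut)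
     \/ (i = 2%N /\ e0 w x = Ball) \/ (i = 3%N /\ e0 w x = Star)]).
    by do ?apply: measurable_set_or; apply: measurable_set_and;
      [exact: measurable_set_const|exact: measurable_init|exact: measurable_set_const|exact: measurable_init
      |exact: measurable_set_const|exact: measurable_init|exact: measurable_set_const|exact: measurable_init].
  apply/seteqP; split=> w /=; first by move=> <-; case: (e0 w x) => /=; tauto.
  by move=> [[-> ->]|[[-> ->]|[[-> ->]|[-> ->]]]].
case: o => [[[u q] r]|]; last first.
  by apply: measurable_set_forall => u; apply: measurable_set_not; exact: measurable_jump.
apply: measurable_set_and; first exact: measurable_jump.
apply: measurable_set_and; first exact: (@measurable_ltfun (fun=> ratr q) (clk u)).
exact: (@measurable_ltfun (clk u) (fun=> ratr r)).
Qed.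

Lemma steps_unit w v k : xi w v k = 1 \/ xi w v k = -1.
Proof. by rewrite /steps_of /stepZ; case: ifP; [left|right]. Qed.

Variable A : set T.
Hypothesis mA : measurable A.
Hypothesis goodA : forall w, A w -> good (e0 w) (C w) (xi w).

Local Notation Phi := (golf_process eta0 clk step).

(** Realizations with the same code have the same jumps in the window, caused by the same balls,
    with clocks in the same short disjoint intervals. A time change close to the identity therefore
    carries the jump times of one to those of the other. *)
Lemma code_nbhd w n (e : R) : A w -> 0 < e -> exists c, code_event c w /\
  forall w', A w' -> code_event c w' -> sk_nbhd (Phi w) n e (Phi w').
Proof.
move=> Aw egt0; have gd := goodA Aw.
have [f Hf] : {f : int -> option int & forall x, match f x with
    Some u => jump (e0 w) (C w) (xi w) u x | None => forall u, ~ jump (e0 w) (C w) (xi w) u x end}.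
  apply: (@choice _ _ (fun x o => match o with
    Some u => jump (e0 w) (C w) (xi w) u x | None => forall u, ~ jump (e0 w) (C w) (xi w) u x end)).
  move=> x; have [[u ju]|no] := pselect (exists u, jump (e0 w) (C w) (xi w) u x).
    by exists (Some u).
  by exists None => u ju; apply: no; exists u.
(* One ball may cause two jumps in the window, at its start and at the hole it fills. *)
pose U := undup (pmap f (window n)).
have memU u : u \in U -> exists2 x, x \in window n & f x = Some u.
  by rewrite mem_undup mem_pmap => /mapP[x xn fxu]; exists x.
have [[c01 cinj] _ _] := gd.
have [q [r [Hqr Hsep]]] := separating_intervals U egt0 c01 cinj.
pose c : code := [seq (x, site_index (e0 w x), omap (fun u => (u, q u, r u)) (f x)) | x <- window n].
exists c; split.
  move=> a /mapP[x xn ->]; split=> //=; have := Hf x; case fxE : (f x) => [u|] //= ju.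
  have Uu : u \in U by rewrite mem_undup mem_pmap; apply/mapP; exists x.
  by have [_ /andP[? ?] _ _] := Hqr u Uu.
move=> w' Aw' cw'; have gd' := goodA Aw'.
have cx x : x \in window n -> code_cond (x, site_index (e0 w x), omap (fun u => (u, q u, r u)) (f x)) w'.
  by move=> xn; apply: cw'; apply/mapP; exists x.
have [|lam [tc close mono ls]] := @time_change_exists R _ U (fun u => ratr (q u)) (fun u => ratr (r u))
   (C w) (C w') e (undup_uniq _) egt0 _ Hsep.
  move=> u Uu; have [? ? ? ?] := Hqr u Uu; split=> //.
  have [x xn fx] := memU u Uu; have [_] := cx x xn.
  by rewrite /= fx /= => -[_ [-> ->]].
exists lam; split=> //; split=> [t _ _|t _ _ x xn]; first exact: close.
have xn' : x \in window n by rewrite mem_window.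
have [/site_index_inj ex] := cx x xn'; rewrite /golf_process (good_path (steps_unit w) gd)
  (good_path (steps_unit w') gd') /= /= in ex * => Hx.
rewrite ex; congr (if _ then _ else _).
have := Hf x; case fxE : (f x) Hx => [u|] /= Hx ju; last first.
  by apply/asboolP/asboolP => -[u [hu _]]; [case: (Hx u)|case: (ju u)].
have Uu : u \in U by rewrite mem_undup mem_pmap; apply/mapP; exists x.
(* The time change is strictly increasing, so it preserves the order of [t] and the clock. *)
have lamu : (C w u <= t) <-> (C w' u <= lam t).
  rewrite -(ls u Uu) !leNgt; split=> /negP h; apply/negP => h'; apply: h; last exact: mono.
  have [//|tu] := ltP t (C w u); move: tu; rewrite le_eqVlt => /orP[/eqP tu|/mono].
    by rewrite tu ltxx in h'.
  by move=> h2; have := lt_trans h' h2; rewrite ltxx.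
apply/asboolP/asboolP => -[v [jv cv]].
  exists u; split=> //; apply/lamu.
  by rewrite (jump_unique (steps_unit w') gd' Hx.1 jv).
exists u; split; first exact: Hx.1.
by apply/lamu; rewrite (jump_unique (steps_unit w) gd ju jv).
Qed.

(** By [code_nbhd] the preimage is a union of code events, over the countably many codes whose event
    within [A] is mapped into [U]. This inclusion does not depend on the realization. *)
Lemma measurable_preimage_open U : sk_open U -> measurable (A `&` Phi @^-1` U).
Proof.
move=> [Ucad Uop].
rewrite (_ : A `&` _ = A `&` [set w | exists c : code,
    (A `&` code_event c `<=` Phi @^-1` U) /\ code_event c w]).
  apply: measurableI => //; apply: measurable_set_exists => c.
  apply: measurable_set_and; [exact: measurable_set_const|exact: measurable_code_event].
apply/seteqP; split=> w [Aw]; last by move=> [c [sub cw]]; split=> //; apply: sub.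
move=> Uw; split=> //; have [n [e egt0 sub]] := Uop _ Uw.
have [c [cw H]] := code_nbhd n Aw egt0.
exists c; split=> // w' [Aw' cw']; apply: sub; split; first exact: H.
exact: good_cadlag (steps_unit w') (goodA Aw').
Qed.

Lemma measurable_preimage_borel B : sk_borel B -> measurable (A `&` Phi @^-1` B).
Proof.
move: B; apply: (@smallest_sub _ (sigma_algebra setT) (@sk_open R)
   [set B | measurable (A `&` Phi @^-1` B)]); last exact: measurable_preimage_open.
split => /=.
- by rewrite preimage_set0 setI0.
- move=> B mB; rewrite (_ : A `&` _ = A `\` (A `&` Phi @^-1` B)).
    exact: measurableD.
  apply/seteqP; split=> w /=; first by case=> Aw [_ nB]; split=> // -[].
  by case=> Aw nB; split=> //; split=> // ?; apply: nB.
- move=> F mF; rewrite preimage_bigcup setI_bigcupr.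
  exact: bigcupT_measurable.
Qed.

End Measurability.

(** * Independent rectangles *)

Section Independence.
Context d (T : measurableType d) (R : realType) (P : probability T R).

Definition pr (E : set T) : R := fine (P E).

Lemma prE E : measurable E -> P E = (pr E)%:E.
Proof. by move=> mE; rewrite /pr fineK // fin_num_measure. Qed.

Lemma pr_fine E r : P E = r%:E -> pr E = r.
Proof. by rewrite /pr => ->. Qed.

Lemma pr_ge0 E : 0 <= pr E.
Proof. by rewrite /pr fine_ge0. Qed.

Lemma pr_setT : pr setT = 1.
Proof. by rewrite /pr probability_setT. Qed.

Lemma pr_set0 : pr set0 = 0.
Proof. by rewrite /pr measure0. Qed.

Lemma pr_le E F : measurable E -> measurable F -> E `<=` F -> pr E <= pr F.
Proof.
by move=> mE mF EF; rewrite -lee_fin -!prE //; apply: le_measure; rewrite ?inE.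
Qed.

Lemma pr_setDI E F : measurable E -> measurable F -> pr E = pr (E `\` F) + pr (E `&` F).
Proof.
move=> mE mF; apply: EFin_inj; rewrite EFinD -!prE //; last 2 first.
- exact: measurableI.
- exact: measurableD.
exact: measureDI.
Qed.

Lemma pr_setU_le E F : measurable E -> measurable F -> pr (E `|` F) <= pr E + pr F.
Proof.
move=> mE mF; rewrite -lee_fin EFinD -!prE //; last exact: measurableU.
exact: measureU2.
Qed.

Lemma pr_bigU_le (I : eqType) (s : seq I) (F : I -> set T) : (forall i, measurable (F i)) ->
  measurable [set w | exists2 i, i \in s & F i w] /\
  pr [set w | exists2 i, i \in s & F i w] <= \sum_(i <- s) pr (F i).
Proof.
move=> mF; elim: s => [|a s [mU le]].
  rewrite big_nil (_ : [set w | _] = set0) ?pr_set0 //.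
  by apply/seteqP; split=> w // -[].
rewrite (_ : [set w | exists2 i, i \in a :: s & F i w] =
    F a `|` [set w | exists2 i, i \in s & F i w]).
  split; first exact: measurableU.
  rewrite big_cons; apply: le_trans (pr_setU_le _ _) _ => //.
  by rewrite lerD2l.
apply/seteqP; split=> w /=.
  by move=> [i]; rewrite inE => /orP[/eqP ->|si Fi]; [left|right; exists i].
by move=> [Fa|[i si Fi]]; [exists a; rewrite ?mem_head|exists i; rewrite // inE si orbT].
Qed.

Lemma negligible_pr E : measurable E -> (forall e : R, 0 < e -> pr E <= e) -> P.-negligible E.
Proof.
move=> mE H; apply/(negligibleP _ mE); apply: etrans (prE mE) _; congr EFin.
apply/eqP; rewrite eq_le pr_ge0 andbT leNgt; apply/negP => h.
have h2 : 0 < pr E / 2 by rewrite divr_gt0.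
by have := H _ h2; lra.
Qed.

Lemma negligible_exists (I : countType) (F : I -> T -> Prop) :
  (forall i, P.-negligible [set w | F i w]) -> P.-negligible [set w | exists i, F i w].
Proof.
move=> nF; apply: (@negligibleS _ _ _ _ (\bigcup_n
    (if (unpickle n : option I) is Some i then [set w | F i w] else set0))).
  by move=> w [i Fi]; exists (pickle i) => //=; rewrite pickleK.
apply: negligible_bigcup => n; case: unpickle => [i|]; first exact: nF.
exact: negligible_set0.
Qed.

Variables (I : countType) (X : I -> T -> R).
Hypothesis mX : forall i, measurable_fun setT (X i).
Hypothesis indX : mutually_independent P X.

(** The list of coordinates is recorded, so that independence can be read off from disjoint
    lists. *)
Definition rectangle (J : seq I) (E : set T) := uniq J /\ exists B : I -> set R,
  (forall i, measurable (B i)) /\ E = [set w | forall i, i \in J -> B i (X i w)].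

Lemma measurable_preX i (B : set R) : measurable B -> measurable (X i @^-1` B).
Proof. by move=> mB; have := mX i measurableT mB; rewrite setTI. Qed.

Lemma rectangle_measurable J E : rectangle J E -> measurable E.
Proof.
move=> [_ [B [mB ->]]]; apply: measurable_set_forall => i.
apply: measurable_set_imp; [exact: measurable_set_const|exact: measurable_preX].
Qed.

Lemma pr_rectangle J (B : I -> set R) : uniq J -> (forall i, measurable (B i)) ->
  pr [set w | forall i, i \in J -> B i (X i w)] = \prod_(i <- J) pr (X i @^-1` B i).
Proof. by move=> uJ mB; have := indX uJ mB. Qed.

(** Both events are rewritten with one family of sides [B2], to which the product formula
    applies. *)
Lemma rectangle_cat J J' E E' : rectangle J E -> rectangle J' E' ->
  (forall i, i \in J -> i \in J' -> False) ->
  rectangle (J ++ J') (E `&` E') /\ pr (E `&` E') = pr E * pr E'.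
Proof.
move=> [uJ [B [mB ->]]] [uJ' [B' [mB' ->]]] dis.
pose B2 i := if i \in J then B i else B' i.
have mB2 i : measurable (B2 i) by rewrite /B2; case: ifP.
have uJJ : uniq (J ++ J').
  rewrite cat_uniq uJ uJ' andbT /=; apply/hasPn => i iJ'.
  by apply/negP => iJ; apply: dis iJ iJ'.
have eqB2 : [set w | forall i, i \in J -> B i (X i w)] `&`
   [set w | forall i, i \in J' -> B' i (X i w)] =
   [set w | forall i, i \in J ++ J' -> B2 i (X i w)].
  apply/seteqP; split=> w /=.
    move=> [H H'] i; rewrite mem_cat /B2; case: ifP => [iJ _|_ /= iJ']; first exact: H.
    exact: H'.
  move=> H; split=> i iJ; have := H i; rewrite mem_cat iJ ?orbT /B2; first by rewrite iJ => /(_ isT).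
  by case: ifP => [iJ2|_] => /(_ isT) //; case: (dis i).
split; first by split=> //; exists B2; rewrite eqB2.
rewrite eqB2 !pr_rectangle // big_cat /=; congr (_ * _).
  by apply: eq_big_seq => i iJ; rewrite /B2 iJ.
apply: eq_big_seq => i iJ; rewrite /B2; case: ifP => // iJ2; by case: (dis i).
Qed.

Lemma rectangle_setT : rectangle [::] setT.
Proof.
split=> //; exists (fun=> setT); split=> [i|]; first exact: measurableT.
by apply/seteqP; split.
Qed.

Lemma rectangle1 i (B : set R) : measurable B -> rectangle [:: i] (X i @^-1` B).
Proof.
move=> mB; split=> //; exists (fun=> B); split=> //.
apply/seteqP; split=> w /=; last by apply; rewrite mem_head.
by move=> Bw j; rewrite inE => /eqP ->.
Qed.

(** * Independent trials and sums over disjoint lists of coordinates *)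

Section DisjointRectangles.
Variables (Js : nat -> seq I).
Hypothesis disjJs : forall i j k, k \in Js i -> k \in Js j -> i = j.

(** Avoiding all trials is not a rectangle, so the step subtracts the hits of [Es n]. Intersecting
    [F] with [Es n] gives a rectangle again, which is why [F] is general. *)
Lemma rectangle_misses (Es : nat -> set T) (q : R) J F n :
  (forall i, rectangle (Js i) (Es i)) -> (forall i, pr (Es i) = q) ->
  rectangle J F -> (forall i k, (i < n)%N -> k \in J -> k \in Js i -> False) ->
  measurable [set w | forall i, (i < n)%N -> ~ Es i w] /\
  pr (F `&` [set w | forall i, (i < n)%N -> ~ Es i w]) = pr F * (1 - q) ^+ n.
Proof.
move=> rE prq; elim: n J F => [|n IH] J F rF dis.
  rewrite (_ : [set w | _] = setT) ?setIT ?mulr1; first by split.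
  by apply/seteqP; split.
have [mN e1] := IH _ _ rF (fun i k lt => dis i k (leqW lt)).
have [rFE e3] := rectangle_cat rF (rE n) (fun k => dis n k (ltnSn n)).
have dis2 i k : (i < n)%N -> k \in J ++ Js n -> k \in Js i -> False.
  move=> lt; rewrite mem_cat => /orP[kJ|kn] ki; first exact: dis (leqW lt) kJ ki.
  by have := disjJs kn ki => ni; rewrite ni ltnn in lt.
have [_ e2] := IH _ _ rFE dis2.
have mE := rectangle_measurable (rE n); have mF := rectangle_measurable rF.
have eN : [set w | forall i, (i < n.+1)%N -> ~ Es i w] =
    [set w | forall i, (i < n)%N -> ~ Es i w] `\` Es n.
  apply/seteqP; split=> w /=.
    by move=> H; split=> [i lt|]; apply: H => //; exact: leqW.
  by move=> [H nE] i; rewrite ltnS leq_eqVlt => /orP[/eqP ->//|]; exact: H.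
split; first by rewrite eN; exact: measurableD.
have := @pr_setDI (F `&` [set w | forall i, (i < n)%N -> ~ Es i w]) (Es n)
  (measurableI _ _ mF mN) mE.
rewrite e1 setIAC e2 e3 prq eN -setIDA exprS => e4.
have -> : pr (F `&` ([set w | forall i, (i < n)%N -> ~ Es i w] `\` Es n)) =
   pr F * (1 - q) ^+ n - pr F * q * (1 - q) ^+ n by rewrite e4 addrK.
by ring.
Qed.

(** Missing the first [n] independent trials has probability [(1 - q) ^+ n], which tends to [0]. *)
Lemma rectangle_hit (Es : nat -> set T) (q : R) : 0 < q ->
  (forall i, rectangle (Js i) (Es i)) -> (forall i, pr (Es i) = q) ->
  P.-negligible [set w | forall i, ~ Es i w].
Proof.
move=> q0 rE prq; apply: negligible_pr => [|e e0].
  apply: measurable_set_forall => i; apply: measurable_set_not; exact: rectangle_measurable (rE i).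
have q1 : q <= 1.
  by rewrite -(prq 0%N) -pr_setT; apply: pr_le => //; exact: rectangle_measurable (rE _).
have : `|1 - q| < 1 by rewrite ger0_norm; lra.
move=> /cvg_expr/cvgrPdist_lt/(_ _ e0)[n _ /(_ n (leqnn n))] /=.
rewrite sub0r normrN => Hn.
have dis i k : (i < n)%N -> k \in [::] -> k \in Js i -> False by [].
have [mN e1] := rectangle_misses rE prq rectangle_setT dis.
rewrite setTI pr_setT mul1r in e1.
apply: le_trans (_ : (1 - q) ^+ n <= e).
  rewrite -e1; apply: pr_le => //; last by move=> w H i _; exact: H.
  apply: measurable_set_forall => i; apply: measurable_set_not; exact: rectangle_measurable (rE i).
by apply: ltW; apply: le_lt_trans Hn; exact: ler_norm.
Qed.

Variables (K : finType) (Ec : nat -> K -> set T) (y : K -> int) (Y : nat -> T -> int).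
Hypothesis rEc : forall i c, rectangle (Js i) (Ec i c).
Hypothesis cover : forall i w, exists c, Ec i c w.
Hypothesis YE : forall i c w, Ec i c w -> Y i w = y c.

(** An exponential Markov inequality without integrals: [q] bounds the mean of [r ^ (- Y i)],
    written as a finite sum over cases. The induction splits on the case of the last summand and
    absorbs it into [F]. *)
Lemma chernoff (r q : R) (k : int) J F n : 1 < r -> 0 <= q ->
  (forall i, \sum_c pr (Ec i c) * r ^ (- y c) <= q) ->
  rectangle J F -> (forall i j, (i < n)%N -> j \in J -> j \in Js i -> False) ->
  measurable [set w | (\sum_(i < n) Y i w <= k)%R] /\
  pr (F `&` [set w | \sum_(i < n) Y i w <= k]) <= pr F * r ^ k * q ^+ n.
Proof.
move=> r1 q0 Hq; have r0 : 0 < r by lra.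
elim: n J F k => [|n IH] J F k rF dis.
  rewrite (_ : [set w | _] = [set w : T | 0 <= k]); last first.
    by apply/seteqP; split=> w /=; rewrite big_ord0.
  split; first exact: measurable_set_const.
  (* For the empty sum the event is empty or everything; in the latter case [r ^ k] is at least
     [1]. *)
  have [k0|k0] := leP 0 k; last first.
    rewrite (_ : [set w : T | _] = set0) ?setI0 ?pr_set0; last by apply/seteqP; split.
    by rewrite mulr1 mulr_ge0 ?pr_ge0 // exprz_ge0 // ltW.
  rewrite (_ : [set w : T | _] = setT) ?setIT; last by apply/seteqP; split.
  rewrite mulr1 ler_peMr ?pr_ge0 //; case: k k0 => // m _.
  by rewrite -exprnP exprn_ege1 // ltW.
have rFc c := rectangle_cat rF (rEc n c) (fun j => dis n j (ltnSn n)).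
have dis2 i j : (i < n)%N -> j \in J ++ Js n -> j \in Js i -> False.
  move=> lt; rewrite mem_cat => /orP[jJ|jn] ji; first exact: dis (leqW lt) jJ ji.
  by have := disjJs jn ji => ni; rewrite ni ltnn in lt.
have IHc c := IH _ _ (k - y c) (rFc c).1 dis2.
have mF := rectangle_measurable rF.
have mEc c := rectangle_measurable (rEc n c).
have eS : [set w | \sum_(i < n.+1) Y i w <= k] =
   [set w | exists c, Ec n c w /\ \sum_(i < n) Y i w <= k - y c].
  apply/seteqP; split=> w /=; rewrite big_ord_recr /=.
    by move=> le; have [c Ew] := cover n w; exists c; split=> //; rewrite -(YE Ew) lerBrDr.
  by move=> [c [Ew]]; rewrite -(YE Ew) lerBrDr.
split.
  rewrite eS; apply: measurable_set_exists => c; have [mS _] := IHc c.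
  by have := measurableI _ _ (mEc c) mS.
have mG c : measurable (F `&` Ec n c `&` [set w | \sum_(i < n) Y i w <= k - y c]).
  by have [mS _] := IHc c; apply: measurableI => //; exact: measurableI.
have [mU leU] := pr_bigU_le (enum K) mG.
have -> : F `&` [set w | \sum_(i < n.+1) Y i w <= k] = [set w | exists2 c, c \in enum K &
    (F `&` Ec n c `&` [set w | \sum_(i < n) Y i w <= k - y c]) w].
  rewrite eS; apply/seteqP; split=> w /=.
    by move=> [Fw [c [Ew le]]]; exists c; rewrite ?mem_enum.
  by move=> [c _ [[Fw Ew] le]]; split=> //; exists c.
apply: le_trans leU _; rewrite big_enum /=.
apply: le_trans (_ : \sum_c pr F * r ^ k * q ^+ n * (pr (Ec n c) * r ^ (- y c)) <= _).
  apply: ler_sum => c _; apply: le_trans (IHc c).2 _.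
  by rewrite (rFc c).2 expfzDr ?gt_eqF // le_eqVlt; apply/orP; left; apply/eqP; ring.
rewrite -mulr_sumr exprSr mulrA ler_wpM2l //.
by rewrite !mulr_ge0 ?pr_ge0 ?exprn_ge0 // exprz_ge0 // ltW.
Qed.

(** The bounds of [chernoff] are summable in [n], so the Borel-Cantelli lemma applies. *)
Lemma sums_cvg_pinfty (r q : R) (k : int) : 1 < r -> 0 < q -> q < 1 ->
  (forall i, \sum_c pr (Ec i c) * r ^ (- y c) <= q) ->
  P.-negligible [set w | ~ exists N : nat, forall n, (N <= n)%N -> k < \sum_(i < n) Y i w].
Proof.
move=> r1 q0 q1 Hq; have r0 : 0 < r by lra.
have q0' := ltW q0.
pose F n := [set w | \sum_(i < n) Y i w <= k].
have bd n : measurable (F n) /\ pr (F n) <= r ^ k * q ^+ n.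
  have dis i j : (i < n)%N -> j \in [::] -> j \in Js i -> False by [].
  have [mS] := @chernoff r q k [::] setT n r1 q0' Hq rectangle_setT dis.
  by rewrite setTI pr_setT mul1r.
apply: (@negligibleS _ _ _ _ (lim_sup_set F)).
  move=> w /= no n _; apply: contrapT => nF; apply: no; exists n => m nm.
  by rewrite ltNge; apply/negP => le; apply: nF; exists m.
have mF n : measurable (F n) := (bd n).1.
apply/negligibleP; first by apply: bigcapT_measurable => n; apply: bigcup_measurable.
apply: lim_sup_set_cvg0 => //.
apply: (@le_lt_trans _ _ (r ^ k * (1 - q)^-1)%:E); last by rewrite ltry.
apply: lime_le; first by apply: is_cvg_nneseries => n _ _; exact: measure_ge0.
apply: nearW => n; rewrite (eq_bigr (fun i => (pr (F i))%:E)); last by move=> i _; exact: prE.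
rewrite sumEFin lee_fin.
have := @geometric_le_lim R n (r ^ k) q (exprz_ge0 _ (ltW r0)) q0.
rewrite ger0_norm // => /(_ q1); apply: le_trans.
by rewrite /series /=; apply: ler_sum => m _; exact: (bd m).2.
Qed.

End DisjointRectangles.
End Independence.

(** * Almost sure properties of the inputs *)

Section GolfInputs.
Context d (T : measurableType d) (R : realType) (P : probability T R).
Variables (rb rh p : R) (eta0 clk : int -> T -> R) (step : int -> nat -> T -> R).
Hypotheses (rb0 : 0 <= rb) (rh0 : 0 <= rh) (rbh1 : rb + rh <= 1) (rbh : rb <= rh).
Hypotheses (p0 : 0 <= p) (p1 : p <= 1).
Hypothesis inputs : golf_inputs P rb rh p eta0 clk step.

Local Notation e0 := (init_of eta0).
Local Notation C := (clocks_of clk).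
Local Notation xi := (steps_of step).
Local Notation X := (golf_family eta0 clk step).
Local Notation pr := (pr P).

Let meta x : measurable_fun setT (eta0 x). Proof. by case: inputs. Qed.
Let mclk x : measurable_fun setT (clk x). Proof. by case: inputs => _ []. Qed.
Let mstep v k : measurable_fun setT (step v k). Proof. by case: inputs => _ [_ []]. Qed.
Let mX i : measurable_fun setT (X i). Proof. by case: i => [[x|v]|[v k]] /=. Qed.
Let indX : mutually_independent P X. Proof. by case: inputs => _ [_ [_ [_ [_ [_]]]]]. Qed.

(** The neutral case is the complement of the values [1] and [-1], as in [site_of], so that the
    three cases cover every realization. *)
Lemma pr_eta x : [/\ pr (eta0 x @^-1` [set 1]) = rb, pr (eta0 x @^-1` [set -1]) = rh &
  pr (eta0 x @^-1` ~` ([set 1] `|` [set -1])) = 1 - rb - rh].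
Proof.
case: inputs => _ [_ [_ [/(_ x)[e1 e2 _] _]]].
have f1 : pr (eta0 x @^-1` [set 1]) = rb by exact: pr_fine.
have f2 : pr (eta0 x @^-1` [set -1]) = rh by exact: pr_fine.
move=> {e1 e2}.
split=> //; have mp (B : set R) : measurable B -> measurable (eta0 x @^-1` B).
  by move=> mB; have := meta x measurableT mB; rewrite setTI.
have m12 : measurable ([set 1] `|` [set -1] : set R) by exact: measurableU.
have := @pr_setDI _ _ _ P setT (eta0 x @^-1` ([set 1] `|` [set -1])) measurableT (mp _ m12).
rewrite setTI setTD pr_setT -preimage_setC.
have := @pr_setDI _ _ _ P (eta0 x @^-1` ([set 1] `|` [set -1])) (eta0 x @^-1` [set 1])
  (mp _ m12) (mp _ (measurable_set1 _)).
have -> : eta0 x @^-1` ([set 1] `|` [set -1]) `&` eta0 x @^-1` [set 1] = eta0 x @^-1` [set 1].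
  by apply/seteqP; split=> w /=; [case|split=> //; left].
have -> : eta0 x @^-1` ([set 1] `|` [set -1]) `\` eta0 x @^-1` [set 1] = eta0 x @^-1` [set -1].
  apply/seteqP; split=> w /=; first by case=> -[].
  by move=> ->; split; [right|move=> h; lra].
rewrite f1 f2; lra.
Qed.

Lemma measurable_clk v (B : set R) : measurable B -> measurable (clk v @^-1` B).
Proof. by move=> mB; have := mclk v measurableT mB; rewrite setTI. Qed.

Lemma pr_clk_le v s : 0 <= s -> s <= 1 -> pr (clk v @^-1` `]-oo, s]) = s.
Proof.
by case: inputs => _ [_ [_ [_ [+ _]]]] s0 s1 => /(_ v s s0 s1)/pr_fine.
Qed.

Lemma pr_clk_gt v s : 0 <= s -> s <= 1 -> pr (clk v @^-1` `]s, +oo[) = 1 - s.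
Proof.
move=> s0 s1.
have := @pr_setDI _ _ _ P setT (clk v @^-1` `]-oo, s]) measurableT
  (measurable_clk v (measurable_itv _)).
rewrite setTI setTD pr_setT pr_clk_le // preimage_setC setCitvl => ->; ring.
Qed.

Lemma pr_clk_oc v a b : 0 <= a -> a <= b -> b <= 1 -> pr (clk v @^-1` `]a, b]) = b - a.
Proof.
move=> a0 ab b1.
have := @pr_setDI _ _ _ P (clk v @^-1` `]-oo, b]) (clk v @^-1` `]-oo, a])
  (measurable_clk v (measurable_itv _)) (measurable_clk v (measurable_itv _)).
have -> : clk v @^-1` `]-oo, b] `&` clk v @^-1` `]-oo, a] = clk v @^-1` `]-oo, a].
  apply/seteqP; split=> w /=; rewrite !in_itv /=; first by case.
  by move=> h; split=> //; lra.
have -> : clk v @^-1` `]-oo, b] `\` clk v @^-1` `]-oo, a] = clk v @^-1` `]a, b].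
  apply/seteqP; split=> w /=; rewrite !in_itv /=.
    by move=> [h /negP]; rewrite -ltNge h => ->.
  by move=> /andP[h ->]; split=> //; apply/negP; rewrite -ltNge.
rewrite !pr_clk_le; lra.
Qed.

Lemma negligible_clock_out v : P.-negligible [set w | ~ 0 < clk v w < 1].
Proof.
have mO a : measurable (clk v @^-1` `]-oo, 0] `|` clk v @^-1` `]a, +oo[).
  by apply: measurableU; apply: measurable_clk; exact: measurable_itv.
apply: negligible_pr => [|e egt0].
  apply: measurable_set_not; apply: (measurable_clk v (measurable_itv `]0, 1[)).
(* The clock exceeds [a] with probability at most [e]; the minimum keeps [a] in the unit interval,
   where the law of the clock is given. *)
pose a := 1 - Num.min e 1.
have [a0 a1 ae] : [/\ 0 <= a, a < 1 & 1 - a <= e].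
  by rewrite /a; case: (leP e 1) => h; split; lra.
apply: le_trans (_ : pr (clk v @^-1` `]-oo, 0] `|` clk v @^-1` `]a, +oo[) <= _).
  apply: pr_le => //.
    apply: measurable_set_not; apply: (measurable_clk v (measurable_itv `]0, 1[)).
  move=> w /= /negP; rewrite negb_and -!leNgt !in_itv /= andbT => /orP[h|h]; [by left|right; lra].
apply: le_trans (pr_setU_le _ _ _) _; try by apply: measurable_clk; exact: measurable_itv.
by rewrite pr_clk_le // pr_clk_gt; lra.
Qed.

Definition site_event (B D : set R) (v : int) : set T := eta0 v @^-1` B `&` clk v @^-1` D.

Definition site_idx (v : int) : seq (int + int + int * nat) := [:: inl (inl v); inl (inr v)].

Lemma site_event_rectangle B D v : measurable B -> measurable D ->
  rectangle X (site_idx v) (site_event B D v) /\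
  pr (site_event B D v) = pr (eta0 v @^-1` B) * pr (clk v @^-1` D).
Proof.
move=> mB mD.
have dis i : i \in [:: inl (inl v) : int + int + int * nat] -> i \in [:: inl (inr v)] -> False.
  by rewrite !inE => /eqP ->.
exact: (rectangle_cat indX (rectangle1 X (inl (inl v)) mB) (rectangle1 X (inl (inr v)) mD) dis).
Qed.

(** Cut the unit interval into [n] pieces of length [1/n]: two independent clocks share a piece with
    probability [n] times [1/n^2], which is below [e] for the chosen [n]. *)
Lemma negligible_clock_eq u v : u <> v -> P.-negligible [set w | clk u w = clk v w].
Proof.
move=> uv; have mE : measurable [set w | clk u w = clk v w].
  have -> : [set w | clk u w = clk v w] = [set w | ~ (clk u w < clk v w) /\ ~ (clk v w < clk u w)].
    apply/seteqP; split=> w /=; first by move=> ->; rewrite ltxx.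
    by move=> [/negP + /negP]; rewrite -!leNgt => h1 h2; apply/eqP; rewrite eq_le h1 h2.
  apply: measurable_set_and; apply: measurable_set_not; first exact: (measurable_ltfun (mclk u) (mclk v)).
  exact: (measurable_ltfun (mclk v) (mclk u)).
have mO : measurable [set w | ~ 0 < clk u w < 1].
  apply: measurable_set_not; apply: (measurable_clk u (measurable_itv `]0, 1[)).
apply: (@negligibleS _ _ _ _ ([set w | ~ 0 < clk u w < 1] `|`
   [set w | 0 < clk u w < 1 /\ clk u w = clk v w])).
  by move=> w /= e; have [h|h] := pselect (0 < clk u w < 1); [right|left].
apply: negligibleU; first exact: negligible_clock_out.
have mI : measurable [set w | 0 < clk u w < 1 /\ clk u w = clk v w].
  by apply: measurable_set_and => //; apply: (measurable_clk u (measurable_itv `]0, 1[)).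
apply: negligible_pr => // e egt0.
have [m _ /(_ m (leqnn m))/= Hm] := near_infty_natSinv_lt (PosNum egt0).
pose n := m.+1%:R : R; have n0 : 0 < n by rewrite ltr0n.
pose I i := `](i%:R / n), (i.+1%:R / n)]%classic : set R.
have rI i : rectangle X [:: inl (inr u); inl (inr v)] (clk u @^-1` I i `&` clk v @^-1` I i) /\
    pr (clk u @^-1` I i `&` clk v @^-1` I i) = pr (clk u @^-1` I i) * pr (clk v @^-1` I i).
  have dis j : j \in [:: inl (inr u) : int + int + int * nat] -> j \in [:: inl (inr v)] -> False.
    by rewrite !inE => /eqP -> /eqP[].
  exact: (rectangle_cat indX (rectangle1 X (inl (inr u)) (measurable_itv _))
    (rectangle1 X (inl (inr v)) (measurable_itv _)) dis).
have [mU leU] := pr_bigU_le P (iota 0 m.+1) (fun i => rectangle_measurable mX (rI i).1).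
apply: le_trans (_ : pr [set w | exists2 i, i \in iota 0 m.+1 &
   (clk u @^-1` I i `&` clk v @^-1` I i) w] <= _).
  apply: pr_le => // w /= [/andP[c0 c1] ce].
  have [|j [xj jmin]] := @nat_argmin (fun j => clk u w <= j%:R / n).
    by exists m.+1; rewrite divff ?gt_eqF // ltW.
  case: j xj jmin => [|i] xj jmin; first by move: xj; rewrite mul0r leNgt c0.
  have xi : i%:R / n < clk u w by rewrite ltNge; apply/negP; apply: jmin.
  have im : (i < m.+1)%N.
    rewrite ltnNge; apply/negP => mi; move: xi; rewrite ltNge => /negP; apply.
    rewrite ler_pdivlMr //; apply: le_trans (_ : 1 * n <= _); first by rewrite ler_pM2r // ltW.
    by rewrite mul1r ler_nat.
  have ii : i \in iota 0 m.+1 by rewrite mem_iota.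
  by exists i; [exact: ii|rewrite /I /= !in_itv /= -ce xi xj].
apply: le_trans leU _.
rewrite (eq_big_seq (fun=> n^-1 * n^-1)); last first.
  move=> i; rewrite mem_iota add0n => /andP[_ im]; rewrite (rI i).2.
  have i1 : i.+1%:R / n <= 1 by rewrite ler_pdivrMr // mul1r ler_nat.
  have ii : i%:R / n <= i.+1%:R / n by rewrite ler_pM2r ?invr_gt0 // ler_nat.
  have i0 : 0 <= i%:R / n by rewrite divr_ge0 // ltW.
  have ee : i.+1%:R / n - i%:R / n = n^-1.
    by rewrite -mulrBl -natr1 addrC addKr mul1r.
  by rewrite !pr_clk_oc // ee.
rewrite big_const_seq count_predT size_iota iter_addr_0 -mulr_natl mulrA divff ?gt_eqF //.
by rewrite mul1r ltW.
Qed.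

Lemma site_idx_disj (sigma : nat -> int) : injective sigma ->
  forall i j k, k \in site_idx (sigma i) -> k \in site_idx (sigma j) -> i = j.
Proof.
by move=> inj i j k; rewrite !inE => /orP[/eqP ->|/eqP ->] /orP[] /eqP // [/inj].
Qed.

Lemma negligible_no_ball_between (q q' : R) b M : 0 < rb -> 0 < q -> q < q' -> q' < 1 ->
  P.-negligible [set w | ~ exists v,
    [/\ beyond b M v, e0 w v = Ball, q < C w v & C w v < q']].
Proof.
move=> rbgt0 q0 qq q1.
pose sigma (i : nat) : int := if b then M - 1 - i%:Z else M + 1 + i%:Z.
have inj : injective sigma by move=> i j; rewrite /sigma; case: (b); lia.
(* The midpoint gives a half-open interval whose clocks stay strictly below [q']. *)
pose m := (q + q') / 2.
apply: (@negligibleS _ _ _ _ [set w | forall i, ~ site_event [set 1] `]q, m] (sigma i) w]).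
  move=> w /= no i [/= e1]; rewrite in_itv /= => /andP[c1 c2].
  apply: no; exists (sigma i); split=> //.
  - by rewrite /beyond /sigma; case: (b); lia.
  - by rewrite /init_of e1; apply/site_ofP.
  - by rewrite /clocks_of; move: c2; rewrite /m; lra.
have rE i := @site_event_rectangle [set 1] `]q, m] (sigma i) (measurable_set1 _) (measurable_itv _).
apply: (rectangle_hit mX indX (site_idx_disj inj) (q := rb * (m - q))).
- by rewrite mulr_gt0 // /m; lra.
- by move=> i; exact: (rE i).1.
- move=> i; rewrite (rE i).2; have [-> _ _] := pr_eta (sigma i).
  by rewrite pr_clk_oc // /m; lra.
Qed.

(** A run of [2M] equal steps moves the walk by [2M], so it starts or ends at distance at least [M]
    from [0]. Disjoint runs are independent trials of the same positive probability. *)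
Lemma negligible_walk_bounded v (M : nat) :
  P.-negligible [set w | ~ exists n, (M <= absz (walk (xi w) v n))%N].
Proof.
have [->|M0] := posnP M.
  apply: (@negligibleS _ _ _ _ set0); last exact: negligible_set0.
  by move=> w /=; apply; exists 0%N.
pose L := (M + M)%N.
pose Js i : seq (int + int + int * nat) := [seq inr (v, k) | k <- iota (i * L) L].
have disj i j k : k \in Js i -> k \in Js j -> i = j.
  move=> /mapP[a + ->] /mapP[c + [ac]]; rewrite -ac !mem_iota => h1 h2.
  have L0 : (0 < L)%N by rewrite /L; lia.
  have aux n : (n * L <= a < n * L + L)%N -> n = (a %/ L)%N.
    move=> h; have -> : a = (n * L + (a - n * L))%N by lia.
    by rewrite divnMDl // divn_small ?addn0 //; lia.
  by rewrite (aux i h1) (aux j h2).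
have key (sg : R) (z : int) (pp : R) : 0 < pp -> `|z| = 1 -> measurable [set sg] ->
    (forall k, pr (step v k @^-1` [set sg]) = pp) -> stepZ sg = z ->
    P.-negligible [set w | ~ exists n, (M <= absz (walk (xi w) v n))%N].
  move=> pp0 z1 msg hpp hz.
  pose Es i := [set w | forall j, j \in Js i -> [set sg] (X j w)].
  apply: (@negligibleS _ _ _ _ [set w | forall i, ~ Es i w]).
    move=> w /= no i Ew; apply: no.
    have wk m : (m <= L)%N -> walk (xi w) v (i * L + m) = walk (xi w) v (i * L) + z * m%:Z.
      elim: m => [|m IH] mL; first by rewrite addn0 mulr0 addr0.
      rewrite addnS walkS IH; last exact: ltnW.
      have := Ew (inr (v, (i * L + m)%N)); rewrite /steps_of => /= ->; first by rewrite hz; lia.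
      by apply/mapP; exists (i * L + m)%N => //; rewrite mem_iota; lia.
    have := wk L (leqnn L); set a := walk _ _ _; set c := walk _ _ _ => ac.
    have [|aM] := leqP M (absz c); first by exists (i * L)%N.
    by exists (i * L + L)%N; rewrite -/a ac; rewrite /L; move: z1 aM; case: (ltrP 0 z) => hz0 z1;
      [have -> : z = 1 by lia|have -> : z = -1 by lia]; lia.
  have uJ i : uniq (Js i) by rewrite map_inj_uniq ?iota_uniq // => a c [].
  apply: (rectangle_hit mX indX disj (q := pp ^+ L)); first exact: exprn_gt0.
    by move=> i; split=> //; exists (fun=> [set sg]).
  move=> i; rewrite (_ : pr (Es i) = \prod_(j <- Js i) pr (X j @^-1` [set sg])); last first.
    exact: (@pr_rectangle _ _ _ _ _ _ indX (Js i) (fun=> [set sg]) (uJ i) (fun=> msg)).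
  rewrite big_map.
  rewrite (eq_bigr (fun=> pp)); last by move=> k _; exact: hpp.
  by rewrite big_const_seq count_predT size_iota iter_mulr_1.
case: inputs => _ [_ [_ [_ [_ [/(_ v) hs _]]]]].
(* At least one of the two directions has positive probability. *)
have [ph|ph] := ltP 0 p.
  apply: (key 1 1 p) => //; first by move=> k; apply: pr_fine; exact: (hs k).1.
  by rewrite /stepZ eqxx.
apply: (key (-1) (-1) (1 - p)) => //; first by lra.
  by move=> k; apply: pr_fine; exact: (hs k).2.
by rewrite /stepZ; case: eqP => // h; have : (-1 : R) <> 1 by move=> h'; lra.
Qed.

Lemma negligible_sums_bounded (sigma : nat -> int) (t : R) (k : int) : injective sigma ->
  0 < rb -> 0 <= t -> t < 1 ->
  P.-negligible [set w | ~ exists N : nat, forall n, (N <= n)%N ->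
     k < \sum_(i < n) drift (e0 w) (C w) t (sigma i)].
Proof.
move=> inj rbgt0 t0 t1.
pose B (c : 'I_4) : set R := match val c with 0%N => [set -1] | 1%N | 2%N => [set 1]
  | _ => ~` ([set 1] `|` [set -1]) end.
pose D (c : 'I_4) : set R := match val c with 1%N => `]-oo, t]%classic | 2%N => `]t, +oo[%classic
  | _ => setT end.
pose y (c : 'I_4) : int := match val c with 0%N => 1 | 1%N => -1 | _ => 0 end.
have mB c : measurable (B c).
  rewrite /B; case: (val c) => [|[|[|_]]] //; apply: measurableC; exact: measurableU.
have mD c : measurable (D c) by rewrite /D; case: (val c) => [|[|[|_]]].
have rE i c := site_event_rectangle (sigma i) (mB c) (mD c).
(* The parameter lies strictly between [t] and [1], and [q] is the mean of [s] to the power of the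
   drift. It equals [1 - (1 - s) * (rh - rb * t / s)], which is below [1] because [t < s] and
   [rb <= rh]. *)
pose s := (1 + t) / 2; have s0 : 0 < s by rewrite /s; lra.
have s1 : s < 1 by rewrite /s; lra.
pose q := rh * s + rb * t * s^-1 + rb * (1 - t) + (1 - rb - rh).
have rh_gt0 : 0 < rh := lt_le_trans rbgt0 rbh.
have rts : rb * t / s < rh.
  rewrite ltr_pdivrMr //; apply: le_lt_trans (ler_wpM2r t0 rbh) _.
  by rewrite ltr_pM2l // /s; lra.
have rt0 : 0 <= rb * t / s by rewrite !mulr_ge0 // invr_ge0 ltW.
have q1 : q < 1.
  have -> : q = 1 - (1 - s) * (rh - rb * t / s) by rewrite /q; field; rewrite gt_eqF.
  by rewrite ltrBlDr ltrDl mulr_gt0 //; lra.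
have h1 : 0 < rh * s by rewrite mulr_gt0.
have h2 : 0 <= rb * (1 - t) by rewrite mulr_ge0 // subr_ge0 ltW.
have q0 : 0 < q by have := rbh1; rewrite /q; lra.
pose Ec i c := site_event (B c) (D c) (sigma i).
have rEc i c : rectangle X (site_idx (sigma i)) (Ec i c) by exact: (rE i c).1.
have cover i w : exists c, Ec i c w.
  have [e1|n1] := pselect (eta0 (sigma i) w = 1).
    have [c1|c1] := leP (clk (sigma i) w) t.
      by exists (@Ordinal 4 1 isT); split=> //=; rewrite /D /= in_itv.
    by exists (@Ordinal 4 2 isT); split=> //=; rewrite /D /= in_itv /= c1.
  have [e2|n2] := pselect (eta0 (sigma i) w = -1); first by exists (@Ordinal 4 0 isT).
  by exists (@Ordinal 4 3 isT); split=> //= -[].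
have YE i c w : Ec i c w -> drift (e0 w) (C w) t (sigma i) = y c.
  case: c => -[|[|[|[|//]]]] cc; rewrite /Ec /site_event /B /D /y /drift /= /init_of /=.
  - by move=> [e1 _]; rewrite (_ : site_of _ = Hole) //; apply/site_ofP.
  - move=> [e1]; rewrite in_itv /= => c1; rewrite (_ : site_of _ = Ball) /clocks_of ?c1 //.
    by apply/site_ofP.
  - move=> [e1]; rewrite in_itv /= andbT => c1; rewrite (_ : site_of _ = Ball); last exact/site_ofP.
    by rewrite /clocks_of leNgt c1.
  - move=> [n1 _]; rewrite (_ : site_of _ = Neut) //; apply/site_ofP.
    by split=> h; apply: n1; [left|right].
have r1 : 1 < s^-1 by rewrite invf_gt1.
apply: (sums_cvg_pinfty mX indX (site_idx_disj inj) rEc cover YE k r1 q0 q1) => i.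
have [f1 f2 f3] := pr_eta (sigma i).
rewrite !big_ord_recr big_ord0 /= !(rE i _).2 /B /D /y /= f1 f2 f3.
rewrite pr_clk_le //; last exact: ltW.
rewrite pr_clk_gt //; last exact: ltW.
by rewrite preimage_setT pr_setT opprK oppr0 expr0z expr1z exprN1 invrK /q; lra.
Qed.

Lemma negligible_ball x : rb = 0 -> P.-negligible [set w | e0 w x = Ball].
Proof.
move=> rbz; apply: (@negligibleS _ _ _ _ (eta0 x @^-1` [set 1])).
  by move=> w /=; move/site_ofP.
have mE : measurable (eta0 x @^-1` [set 1]).
  by have := meta x measurableT (measurable_set1 1); rewrite setTI.
apply: negligible_pr => // e egt0; have [-> _ _] := pr_eta x; lra.
Qed.

Lemma negligible_not_good : P.-negligible [set w | ~ good (e0 w) (C w) (xi w)].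
Proof.
pose bad1 := [set w | exists v, ~ 0 < clk v w < 1].
pose bad2 := [set w | exists uv : int * int, uv.1 <> uv.2 /\ clk uv.1 w = clk uv.2 w].
pose bad3 := [set w | exists vM : int * nat, ~ exists n, (vM.2 <= absz (walk (xi w) vM.1 n))%N].
have n1 : P.-negligible bad1 by apply: negligible_exists; exact: negligible_clock_out.
have n2 : P.-negligible bad2.
  apply: negligible_exists => -[u v] /=; have [uv|uv] := pselect (u = v).
    by apply: (@negligibleS _ _ _ _ set0); [move=> w []|exact: negligible_set0].
  by apply: (negligibleS _ (negligible_clock_eq uv)) => w [].
have n3 : P.-negligible bad3.
  by apply: negligible_exists => -[v M]; exact: negligible_walk_bounded.
have [bad4 n4 H4] : exists2 bad4, P.-negligible bad4 & forall w, ~ bad4 w ->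
    (forall v, e0 w v <> Ball) \/
    (sums_diverge (e0 w) (C w) /\ balls_everywhere (e0 w) (C w)).
  (* If [rb = 0], almost surely there are no balls; otherwise [rb > 0] provides both the balls and
     the drift. *)
  have [rbz|rbn] := eqVneq rb 0.
    exists [set w | exists x, e0 w x = Ball].
      by apply: negligible_exists => x; exact: negligible_ball.
    by move=> w nb; left=> v bv; apply: nb; exists v.
  have rbgt0 : 0 < rb by rewrite lt_neqAle eq_sym rbn.
  pose bal (a : rat * rat * bool * int) w := (0 < a.1.1.1 /\ a.1.1.1 < a.1.1.2 /\ a.1.1.2 < 1) /\
    ~ exists v, [/\ beyond a.1.2 a.2 v, e0 w v = Ball, ratr a.1.1.1 < C w v & C w v < ratr a.1.1.2].
  pose sm (a : nat * int * bool) w := ~ exists N : nat, forall n, (N <= n)%N ->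
     a.1.2 < \sum_(i < n) drift (e0 w) (C w) (1 - a.1.1.+1%:R^-1) (if a.2 then Posz i else Negz i).
  exists ([set w | exists a, bal a w] `|` [set w | exists a, sm a w]).
    apply: negligibleU; apply: negligible_exists.
      move=> [[[q q'] b] M]; rewrite /bal /=.
      have [[h1 [h2 h3]]|nh] := pselect (0 < q /\ q < q' /\ q' < 1); last first.
        by apply: (@negligibleS _ _ _ _ set0); [move=> w []|exact: negligible_set0].
      apply: (negligibleS _ (@negligible_no_ball_between (ratr q) (ratr q') b M rbgt0 _ _ _)).
      - by move=> w [].
      - by rewrite ltr0q.
      - by rewrite ltr_rat.
      - by rewrite -(rmorph1 (@ratr R)) ltr_rat.
    move=> [[k K] b].
    have k0 : 0 < k.+1%:R^-1 :> R by rewrite invr_gt0 ltr0n.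
    have k1 : k.+1%:R^-1 <= 1 :> R by rewrite invf_le1 ?ltr0n // ler1n.
    apply: (@negligible_sums_bounded (fun i => if b then Posz i else Negz i)) => //=.
    - by move=> i j; case: (b) => -[].
    - by rewrite subr_ge0.
  move=> w nb; right; split.
    move=> k K.
    have [N1 H1] : exists N : nat, forall n, (N <= n)%N ->
       K < \sum_(i < n) drift (e0 w) (C w) (1 - k.+1%:R^-1) (Posz i).
      by apply: contrapT => no; apply: nb; right; exists (k, K, true).
    have [N2 H2] : exists N : nat, forall n, (N <= n)%N ->
       K < \sum_(i < n) drift (e0 w) (C w) (1 - k.+1%:R^-1) (Negz i).
      by apply: contrapT => no; apply: nb; right; exists (k, K, false).
    exists (maxn N1 N2) => n; rewrite geq_max => /andP[h1 h2].
    by split; [exact: H1|exact: H2].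
  move=> q q' h1 h2 h3 b M; apply: contrapT => no; apply: nb; left.
  by exists (q, q', b, M).
apply: (@negligibleS _ _ _ _ (bad1 `|` bad2 `|` bad3 `|` bad4)); last first.
  by apply: negligibleU => //; apply: negligibleU => //; apply: negligibleU.
move=> w /= ng; apply: contrapT => nb; apply: ng; split.
- split=> [v|u v cuv].
    by apply: contrapT => no; apply: nb; left; left; left; exists v.
  by apply: contrapT => no; apply: nb; left; left; right; exists (u, v).
- move=> v M; apply: contrapT => no; apply: nb; left; right.
  by exists (v, M).
- by apply: H4 => b4; apply: nb; right.
Qed.

Lemma golf_inputs_valid : golf_valid P eta0 clk step.
Proof.
have [N [mN PN badN]] := negligible_not_good.
have goodA w : (~` N) w -> good (e0 w) (C w) (xi w).
  by move=> nN; apply: contrapT => /badN.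
have mA : measurable (~` N) by exact: measurableC.
exists (~` N); split=> //.
- by rewrite probability_setC // PN sube0.
- move=> w /goodA gd; have su := steps_unit step w.
  by split; [exact: good_well_defined|exact: good_not_frozen|exact: good_cadlag].
- by move=> B; apply: measurable_preimage_borel.
Qed.

End GolfInputs.

Theorem mainTheorem5 (R : realType) (d : measure_display) (T : measurableType d)
    (P : probability T R) (rb rh : R) :
  0 <= rb -> 0 <= rh -> rb + rh <= 1 -> rb <= rh ->
  forall (p : R), 0 <= p -> p <= 1 ->
  forall (eta0 clk : int -> T -> R) (step : int -> nat -> T -> R),
    golf_inputs P rb rh p eta0 clk step ->
    golf_valid P eta0 clk step.
Proof.
by move=> rb0 rh0 rbh1 rbh p p0 p1 eta0 clk step; exact: golf_inputs_valid.
Qed.
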